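(* Consider the problem $\min_{x\in X}\psi_0(x)$ s.t. $\psi_i(x)\le 0$, $i=1,\dots,m$, and the Aug-ConEx method, both described in the context, in the strongly convex case $\mu_f>0$. Let $B\ge0$, $K\ge2$, and let $(x^*,y^* )$ be a saddle point of the Lagrangian. Suppose Aug-ConEx is run for $k=1,\dots,K-1$ with $\tau_1=1$, $\rho_1=\frac{\mu_f}{2(M_g+M_\chi)^2}$ and $$\tau_{k+1}=\tfrac{\tau_k}{2}\big(\sqrt{\tau_k^2+4}-\tau_k\big),\quad \rho_{k+1}=\tfrac{\rho_1}{\tau_{k+1}^2},\quad \eta_k=\rho_k,\quad \beta_{k+1}=\tfrac{(1-\tau_k)\tau_kL_k}{\tau_k^2L_k+L_{k+1}\tau_{k+1}},$$ $$L_k=2\big(L_f+BL_g+\rho_k(M_g+M_\chi)^2\big).$$ Then $$\mathbb E[\psi_0(x_K)-\psi_0(x^* )]\le\tfrac{4}{K^2}\Big[4(L_f+BL_g)D_X^2+\tfrac{1}{2\eta_1}\|y_1\|^2\Big]+\tfrac{8(K+2)(H_f^2+\sigma^2)}{\mu_fK^2},$$ $$\mathbb E\big[\|[\psi(x_K)]_+\|\big]\le\tfrac{4}{K^2}\Big[(L_f+BL_g)\|x_1-x^*\|^2+\tfrac{1}{2\eta_1}\mathbb E\|y_1-\hat y\|^2\Big]+\tfrac{4(K+2)(\mathcal H_*^2+2(H_f^2+\sigma^2))}{\mu_fK^2},$$ where $\hat y=(\|y^*\|+1)\dfrac{[\psi(x_K)]_+}{\|[\psi(x_K)]_+\|}$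 (with $\hat y:=0$ if $[\psi(x_K)]_+=0$) and $\mathcal H_*=L_gD_X[\|y^*\|+1-B]_++H_g(\|y^*\|+1)$. Moreover, $$\mathbb E\Big[\big\|\tfrac{1}{\tau_{K-1}}[x_K-(1-\tau_{K-1})x_{K-1}]-x^*\big\|^2\Big]\le\tfrac{8}{\mu_fK^2}\Big[4(L_f+BL_g)\|x_1-x^*\|^2+\tfrac{2}{\eta_1}\|y_1-y^*\|^2+\tfrac{4(K+2)\left((L_gD_X[\|y^*\|-B]_++H_g\|y^*\|)^2+2(H_f^2+\sigma^2)\right)}{\mu_f}\Big].$$
   Context: **Problem.** $X\subset\mathbb R^n$ is convex and compact, $D_X:=\max_{x,y\in X}\|x-y\|/2$ (Euclidean norms throughout). $\psi_0=f+\chi_0$, $\psi_i=g_i+\chi_i$ for $i=1,\dots,m$; $f,g_i:X\to\mathbb R$ are convex, $\chi_0$ is convex, proper, lower semicontinuous, $\chi_1,\dots,\chi_m$ are continuous and convex. Write $\psi=(\psi_1,\dots,\psi_m)^\top$, $g=(g_1,\dots,g_m)^\top$, $\chi=(\chi_1,\dots,\chi_m)^\top$, and $g'(x)=[g_1'(x),\dots,g_m'(x)]\in\mathbb R^{n\times m}$ with $g_i'(x)\in\partial g_i(x)$. $[\cdot]_+$ is the (elementwise) positive part. $f$ is $\mu_f$-strongly convex: $f(x)\ge f(y)+\langle f'(y),x-y\rangle+\frac{\mu_f}{2}\|x-y\|^2$ for $x,y\in X$. **Assumptions.** For all $x,y\in X$, all $f'(y)\in\partial f(y)$, $g_i'(y)\in\partial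 g_i(y)$, $i=1,\dots,m$ (all constants nonnegative): - $f(x)-f(y)-\langle f'(y),x-y\rangle\le\frac{L_f}{2}\|x-y\|^2+H_f\|x-y\|$; - $g_i(x)-g_i(y)-\langle g_i'(y),x-y\rangle\le\frac{L_{g_i}}{2}\|x-y\|^2+H_{g_i}\|x-y\|$; - $g_i(x)-g_i(y)\le M_{g_i}\|x-y\|$ and $\chi_i(x)-\chi_i(y)\le M_{\chi_i}\|x-y\|$. Set $L_g=(\sum_iL_{g_i}^2)^{1/2}$, $H_g=(\sum_iH_{g_i}^2)^{1/2}$, $M_g=(\sum_iM_{g_i}^2)^{1/2}$, $M_\chi=(\sum_iM_{\chi_i}^2)^{1/2}$, with $M_g+M_\chi>0$. Here $\partial h(x)$, for $x$ in the relative interior of $X$, consists of the subgradients lying in the linear span of $X-X$, and at other points of $X$ of limits of such subgradients along sequences of relative interior points converging to $x$; in particular $\|g_i'(x)\|\le M_{g_i}$. **Stochastic oracle.** For $x\in X$, $\mathfrak F(x,\xi)$ satisfies $\mathbb E[\mathfrak F(x,\xi)]=f'(x)\in\partial f(x)$ and $\mathbb E\|\mathfrak F(x,\xi)-f'(x)\|^2\le\sigma^2$. The samples $\xi_1,\xi_2,\dots$ are independent, and $\xi_k$ is independent of the query point $\hat x_k$ and all quantities generated before iteration $k$. **Saddle point.** With $\mathcal L(x,y)=\psi_0(x)+\langle y,\psi(x)\rangle$, it is assumed that there is $(x^*,y^* )\in X\times\mathbb R^m_+$ with $\mathcal L(x^*,y)\le\mathcal L(x^*,y^* )\le\mathcal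 L(x,y^* )$ for all $(x,y)\in X\times\mathbb R^m_+$, and $\mathcal L(x^*,y^* )$ finite. Then $x^*$ is an optimal solution. **Aug-ConEx method.** Input $x_1\in X$, $y_1\in\mathbb R^m$ (deterministic), and parameters $\rho_k,\eta_k,L_k>0$, $\tau_k\in(0,1]$, $\beta_{k+1}$. Set $\hat x_1=x_1$, $\tilde y_1=y_1$, $s_1=0$, $V_1=g(x_1)+\chi(x_1)$. For $k=1,\dots,K-1$, with $\ell_g(x):=g(\hat x_k)+g'(\hat x_k)^\top(x-\hat x_k)$, find $(s_{k+1},x_{k+1})$ satisfying simultaneously $$s_{k+1}=\arg\min_{s\le 0}\ \langle-\tilde y_k,s\rangle+\tfrac{\rho_k}{2}\|\ell_g(x_{k+1})+\chi(x_{k+1})-(1-\tau_k)V_k-s\|^2,$$ $$x_{k+1}=\arg\min_{x\in X}\ \chi_0(x)+\langle y_{k+1},\chi(x)\rangle+\langle\mathfrak F(\hat x_k,\xi_k)+g'(\hat x_k)y_{k+1},x\rangle+\tfrac{L_k}{2}\|x-\hat x_k\|^2,$$ where $\tilde V_{k+1}=\ell_g(x_{k+1})+\chi(x_{k+1})-s_{k+1}$ and $y_{k+1}=\tilde y_k+\rho_k(\tilde V_{k+1}-(1-\tau_k)V_k)$. Then set $V_{k+1}=g(x_{k+1})+\chi(x_{k+1})-s_{k+1}$, $\tilde y_{k+1}=\tilde y_k+\eta_k(\tilde V_{k+1}-(1-\tau_k)V_k)$, $\hat x_{k+1}=x_{k+1}+\beta_{k+1}(x_{k+1}-x_k)$.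 Output $x_K$. The first-order information of $f,g_i$ is evaluated at $\hat x_k$, so the points $\hat x_k$ are understood to lie in $X$. *)

(* Defs.v *)
From HB Require Import structures.
From mathcomp Require Import all_boot all_order all_algebra.
From mathcomp Require Import all_classical all_reals all_analysis.

Set Implicit Arguments.
Unset Strict Implicit.
Unset Printing Implicit Defensive.

Import Order.TTheory GRing.Theory Num.Theory.
Import numFieldNormedType.Exports.

Local Open Scope classical_set_scope.
Local Open Scope ring_scope.

(* Points of R^n are row vectors 'rV[R]_n.  The library norm `|v| on 'rV[R]_n is the sup norm (which induces
   the same topology), hence the Euclidean norm [enorm] below.  A Jacobian
   matrix is stored with the gradients as its rows, i.e. transposed with
   respect to column-vector notation: g'(x) y is [y *m G] and g'(x)^T d is
   [d *m G^T]. *)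

Section Euclidean.
Context {R : realType} {n : nat}.
Implicit Types (u v : 'rV[R]_n) (X : set 'rV[R]_n).

Definition dotv u v : R := \sum_(i < n) u 0 i * v 0 i.

Definition enorm v : R := Num.sqrt (\sum_(i < n) v 0 i ^+ 2).

Definition pospart v : 'rV[R]_n := \row_(i < n) Num.max (v 0 i) 0.

(* For X nonempty and compact the supremum is a maximum. *)
Definition half_diam X : R :=
  sup [set enorm (p.1 - p.2) / 2 | p in X `*` X].

(* The linear span of X - X. *)
Definition dir_space X : set 'rV[R]_n :=
  [set v | exists2 s : seq 'rV[R]_n,
     (forall w, w \in s -> exists a b, [/\ X a, X b & w = a - b]) &
     v \in span s].

(* For x in X the affine hull of X is x + dir_space X. *)
Definition rel_interior X : set 'rV[R]_n :=
  [set x | X x /\ \forall z \near x, dir_space X (z - x) -> X z].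

Definition subgradient X (h : 'rV[R]_n -> R) (x v : 'rV[R]_n) : Prop :=
  forall z, X z -> h x + dotv v (z - x) <= h z.

Definition ri_subdiff X (h : 'rV[R]_n -> R) (x : 'rV[R]_n) : set 'rV[R]_n :=
  [set v | [/\ rel_interior X x, dir_space X v & subgradient X h x v]].

(* At relative interior points of X: the subgradients lying in span (X - X).
   At the other points of X: the limits of such subgradients along sequences of
   relative interior points. *)
Definition subdiff X (h : 'rV[R]_n -> R) (x : 'rV[R]_n) : set 'rV[R]_n :=
  [set v | ri_subdiff X h x v \/
    [/\ X x, ~ rel_interior X x &
      exists xs vs : nat -> 'rV[R]_n,
        [/\ forall j, ri_subdiff X h (xs j) (vs j),
            xs @ \oo --> x & vs @ \oo --> v]]].

Definition strongly_convex X (h : 'rV[R]_n -> R) (mu : R) : Prop :=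
  forall x y v, X x -> X y -> subdiff X h y v ->
    h y + dotv v (x - y) + mu / 2 * enorm (x - y) ^+ 2 <= h x.

Definition upper_model X (h : 'rV[R]_n -> R) (L H : R) : Prop :=
  forall x y v, X x -> X y -> subdiff X h y v ->
    h x - h y - dotv v (x - y)
      <= L / 2 * enorm (x - y) ^+ 2 + H * enorm (x - y).

Definition lipschitz_bound X (h : 'rV[R]_n -> R) (M : R) : Prop :=
  forall x y, X x -> X y -> h x - h y <= M * enorm (x - y).

Definition proper_on X (h : 'rV[R]_n -> \bar R) : Prop :=
  (forall x, X x -> h x != -oo%E) /\ (exists2 x, X x & h x \is a fin_num).

Definition econvex_on X (h : 'rV[R]_n -> \bar R) : Prop :=
  forall (x y : 'rV[R]_n) (t : R), X x -> X y -> 0 <= t <= 1 ->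
    (h (t *: x + (1 - t) *: y)%R <= t%:E * h x + (1 - t)%:E * h y)%E.

End Euclidean.

Definition is_argmin (A : Type) d (U : porderType d)
    (D : set A) (phi : A -> U) (a : A) : Prop :=
  D a /\ forall z, D z -> (phi a <= phi z)%O.

Section Lagrangian.
Context {R : realType} {n m : nat}.
Variables (X : set 'rV[R]_n).
Variables (psi0 : 'rV[R]_n -> \bar R) (psi : 'rV[R]_n -> 'rV[R]_m).

Definition lagrangian (x : 'rV[R]_n) (y : 'rV[R]_m) : \bar R :=
  (psi0 x + (dotv y (psi x))%:E)%E.

Definition nonneg_orthant : set 'rV[R]_m := [set y | forall i, 0 <= y 0 i].

Definition saddle_point (xs : 'rV[R]_n) (ys : 'rV[R]_m) : Prop :=
  [/\ X xs, nonneg_orthant ys,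
      forall x y, X x -> nonneg_orthant y ->
        (lagrangian xs y <= lagrangian xs ys)%E /\
        (lagrangian xs ys <= lagrangian x ys)%E
    & lagrangian xs ys \is a fin_num].

End Lagrangian.

(* One trajectory of the method, [xh] standing for \hat x, [yt] for \tilde y and
   [Vt] for \tilde V.  Indices start at 1 (at 2 for [it_Vt]); the values at
   smaller indices are meaningless. *)
Record iterates (R : realType) (n m : nat) := Iterates {
  it_x  : nat -> 'rV[R]_n;
  it_xh : nat -> 'rV[R]_n;
  it_s  : nat -> 'rV[R]_m;
  it_y  : nat -> 'rV[R]_m;
  it_yt : nat -> 'rV[R]_m;
  it_V  : nat -> 'rV[R]_m;
  it_Vt : nat -> 'rV[R]_m
}.

Section Method.
Context {R : realType} {n m : nat}.
Variables (X : set 'rV[R]_n) (chi0 : 'rV[R]_n -> \bar R).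
Variables (g chi : 'rV[R]_n -> 'rV[R]_m) (G : 'rV[R]_n -> 'M[R]_(m, n)).
Variables (rho eta L tau beta : nat -> R).

Definition linearization (xh x : 'rV[R]_n) : 'rV[R]_m :=
  g xh + (x - xh) *m (G xh)^T.

(* [gk] is the stochastic gradient used at iteration k. *)
Definition aug_conex_step (it : iterates R n m) (k : nat) (gk : 'rV[R]_n) :
    Prop :=
  let xh := it_xh it k in
  let r x := linearization xh x + chi x in
  is_argmin [set s : 'rV[R]_m | forall i, s 0 i <= 0]
    (fun s => dotv (- it_yt it k) s
       + rho k / 2 *
         enorm (r (it_x it k.+1) - (1 - tau k) *: it_V it k - s) ^+ 2)
    (it_s it k.+1) /\
  is_argmin X
    (fun x => (chi0 x + (dotv (it_y it k.+1) (chi x)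
       + dotv (gk + it_y it k.+1 *m G xh) x
       + L k / 2 * enorm (x - xh) ^+ 2)%:E)%E)
    (it_x it k.+1) /\
  it_Vt it k.+1 = r (it_x it k.+1) - it_s it k.+1 /\
  it_y it k.+1 =
    it_yt it k + rho k *: (it_Vt it k.+1 - (1 - tau k) *: it_V it k) /\
  it_V it k.+1 = g (it_x it k.+1) + chi (it_x it k.+1) - it_s it k.+1 /\
  it_yt it k.+1 =
    it_yt it k + eta k *: (it_Vt it k.+1 - (1 - tau k) *: it_V it k) /\
  it_xh it k.+1 =
    it_x it k.+1 + beta k.+1 *: (it_x it k.+1 - it_x it k).

Definition aug_conex (K : nat) (x1 : 'rV[R]_n) (y1 : 'rV[R]_m)
    (sgrad : nat -> 'rV[R]_n) (it : iterates R n m) : Prop :=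
  (it_x it 1%N = x1 /\ it_y it 1%N = y1 /\
   it_xh it 1%N = x1 /\ it_yt it 1%N = y1 /\ it_s it 1%N = 0 /\
   it_V it 1%N = g x1 + chi x1) /\
  forall k, (1 <= k < K)%N -> aug_conex_step it k (sgrad k).

End Method.

(* R^n with its Borel sigma-algebra. *)
Definition borel_rV (R : realType) (n : nat) :=
  g_sigma_algebraType (@open 'rV[R]_n).

Section Stochastic.
Context d d' (T : measurableType d) (Om : measurableType d') (R : realType).
Variable P : probability T R.

(* The sigma-algebra generated by a map into R^n. *)
Definition vec_events n (Z : T -> 'rV[R]_n) : set (set T) :=
  preimage_set_system setT (Z : T -> borel_rV R n) measurable.

Definition mutually_independent (D : set nat) (xi : nat -> {RV P >-> Om}) :
    Prop :=
  forall (J : seq nat) (E : nat -> set Om),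
    uniq J -> (forall j, j \in J -> D j) -> (forall j, measurable (E j)) ->
    P (\bigcap_(j in [set` J]) (xi j @^-1` E j))
      = (\prod_(j <- J) P (xi j @^-1` E j))%E.

Definition independent_of (Z : {RV P >-> Om}) (F : set (set T)) : Prop :=
  forall (E : set Om) (A : set T), measurable E -> F A ->
    P ((Z @^-1` E) `&` A) = (P (Z @^-1` E) * P A)%E.

(* The sigma-algebra generated by everything produced before iteration k: all
   iterates with index at most k, and the stochastic gradients of the iterations
   j < k. *)
Definition past n m (it : T -> iterates R n m) (sgrad : nat -> T -> 'rV[R]_n)
    (k : nat) : set (set T) :=
  <<s \bigcup_(j in [set j | (1 <= j <= k)%N])
        (vec_events (fun w => it_x (it w) j) `|`
         vec_events (fun w => it_xh (it w) j) `|`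
         vec_events (fun w => it_s (it w) j) `|`
         vec_events (fun w => it_y (it w) j) `|`
         vec_events (fun w => it_yt (it w) j) `|`
         vec_events (fun w => it_V (it w) j)) `|`
      \bigcup_(j in [set j | (1 <= j < k)%N])
        (vec_events (fun w => it_Vt (it w) j.+1) `|`
         vec_events (sgrad j)) >>.

(* Unbiased oracle with variance at most sigma^2; [F] is jointly measurable so
   that F(Z, xi) is a random vector for every random point Z of X. *)
Definition stochastic_oracle n (X : set 'rV[R]_n)
    (F : 'rV[R]_n -> Om -> 'rV[R]_n) (f' : 'rV[R]_n -> 'rV[R]_n) (sigma : R)
    (D : set nat) (xi : nat -> {RV P >-> Om}) : Prop :=
  measurable_fun ((X : set (borel_rV R n)) `*` [set: Om])
    (fun p : borel_rV R n * Om => (F p.1 p.2 : borel_rV R n)) /\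
  forall k x, D k -> X x ->
    (forall i, 'E_P[fun w => (F x (xi k w) 0 i)%R] = (f' x 0 i)%R%:E)%E /\
    ('E_P[fun w => (enorm (F x (xi k w) - f' x) ^+ 2)%R] <= (sigma ^+ 2)%:E)%E.

End Stochastic.

(* Main.v *)
Require Import Defs.
From HB Require Import structures.
From mathcomp Require Import all_boot all_order all_algebra.
From mathcomp Require Import all_classical all_reals all_analysis.
From mathcomp Require Import measurable_realfun.
From mathcomp Require Import ring lra.

Set Implicit Arguments.
Unset Strict Implicit.
Unset Printing Implicit Defensive.

Import Order.TTheory GRing.Theory Num.Theory.
Import numFieldNormedType.Exports.

Local Open Scope classical_set_scope.
Local Open Scope ring_scope.

(* Since eta = rho, the dual sequences y and \tilde y coincide.  The s-step is a
   projection onto the nonpositive orthant, so it makes y_{k+1} nonnegative and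
   orthogonal to s_{k+1}; the slack s only increases V above psi(x), and
   (y_{k+1} - y_k) / rho_k is the residual \tilde V_{k+1} - (1 - tau_k) V_k.
   The three-point inequality of the x-step, tested at
   (1 - tau_k) x_k + tau_k xs, then gives a one-step inequality for the gap
   psi0(x_k) + <y, V_k> - psi0(xs) with an arbitrary multiplier y >= 0, in which
   the term mu / (2 tau_k^2) of L_k / 2 absorbs, by Young's inequality, the
   nonsmooth parts, the oracle noise and the part of |y| L_g exceeding B L_g.
   Divided by tau_k^2 it telescopes: (1 - tau_{k+1}) / tau_{k+1}^2 = 1 / tau_k^2,
   rho_k tau_k^2 is constant, and beta_{k+1} is the extrapolation for which
   strong convexity turns L_{k+1} = L_k + mu / tau_{k+1} into a telescoping
   distance term.

   The three bounds are the choices y = 0, y = \hat y (for which the saddle point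
   turns the gap into the infeasibility) and y = ys (for which the gap is
   nonnegative).  The multiplier may be random because the inequality holds along
   every trajectory; only the noise is averaged, and its linear part has mean
   zero by Fubini's theorem on (past) x (sample). *)

(** * Euclidean geometry, convexity and step sizes *)

Section EuclideanTheory.
Context {R : realType} {n : nat}.
Implicit Types (u v w : 'rV[R]_n) (a t : R).

Lemma dotvC u v : dotv u v = dotv v u.
Proof. by apply: eq_bigr => i _; rewrite mulrC. Qed.

Lemma dotvDr u v w : dotv u (v + w) = dotv u v + dotv u w.
Proof.
by rewrite /dotv -big_split; apply: eq_bigr => i _; rewrite !mxE mulrDr.
Qed.

Lemma dotvZr a u v : dotv u (a *: v) = a * dotv u v.
Proof. by rewrite /dotv mulr_sumr; apply: eq_bigr => i _; rewrite !mxE; ring. Qed.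

Lemma dotvNr u v : dotv u (- v) = - dotv u v.
Proof. by rewrite -scaleN1r dotvZr mulN1r. Qed.

Lemma dotvBr u v w : dotv u (v - w) = dotv u v - dotv u w.
Proof. by rewrite dotvDr dotvNr. Qed.

Lemma dotvDl u v w : dotv (u + v) w = dotv u w + dotv v w.
Proof. by rewrite dotvC dotvDr !(dotvC w). Qed.

Lemma dotvZl a u v : dotv (a *: u) v = a * dotv u v.
Proof. by rewrite dotvC dotvZr dotvC. Qed.

Lemma dotvNl u v : dotv (- u) v = - dotv u v.
Proof. by rewrite dotvC dotvNr dotvC. Qed.

Lemma dotvBl u v w : dotv (u - v) w = dotv u w - dotv v w.
Proof. by rewrite dotvDl dotvNl. Qed.

Lemma dotv0 u : dotv u 0 = 0.
Proof. by rewrite -[0]subr0 dotvBr subrr. Qed.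

Lemma dot0v u : dotv 0 u = 0.
Proof. by rewrite dotvC dotv0. Qed.

Definition dotvE := (dotvDl, dotvDr, dotvNl, dotvNr, dotvZl, dotvZr).

Lemma dotvv_ge0 u : 0 <= dotv u u.
Proof. by apply: sumr_ge0 => i _; rewrite -expr2 sqr_ge0. Qed.

Lemma enorm_sqr u : enorm u ^+ 2 = dotv u u.
Proof.
rewrite sqr_sqrtr; last by apply: sumr_ge0 => i _; exact: sqr_ge0.
by apply: eq_bigr => i _; rewrite expr2.
Qed.

Lemma enorm_ge0 u : 0 <= enorm u.
Proof. exact: sqrtr_ge0. Qed.

Lemma enorm0 : enorm (0 : 'rV[R]_n) = 0.
Proof.
by rewrite /enorm big1 ?sqrtr0// => i _; rewrite mxE expr0n.
Qed.

Lemma enorm_eq0 u : enorm u = 0 -> u = 0.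
Proof.
move=> u0; have : dotv u u == 0 by rewrite -enorm_sqr u0 expr0n.
rewrite psumr_eq0 => [/allP uu0|i _]; last by rewrite -expr2 sqr_ge0.
apply/rowP => i; have := uu0 i (mem_index_enum i).
by rewrite /= mxE mulf_eq0 orbb => /eqP.
Qed.

Lemma enormZ a u : 0 <= a -> enorm (a *: u) = a * enorm u.
Proof.
move=> a0; apply/eqP; rewrite -(@eqrXn2 _ 2) ?mulr_ge0 ?enorm_ge0//.
by apply/eqP; rewrite exprMn !enorm_sqr !dotvE; ring.
Qed.

Lemma enorm_distC u v : enorm (u - v) = enorm (v - u).
Proof.
apply/eqP; rewrite -(@eqrXn2 _ 2) ?enorm_ge0//; apply/eqP.
by rewrite !enorm_sqr !dotvE (dotvC u v); ring.
Qed.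

(* Nonnegativity of [| |v| u - |u| v |^2]. *)
Lemma cauchy_schwarz u v : dotv u v <= enorm u * enorm v.
Proof.
have [u0|u0] := eqVneq (enorm u) 0.
  by rewrite (enorm_eq0 u0) dot0v enorm0 mul0r.
have [v0|v0] := eqVneq (enorm v) 0.
  by rewrite (enorm_eq0 v0) dotv0 enorm0 mulr0.
have uv0 : 0 < 2 * (enorm u * enorm v).
  by rewrite !mulr_gt0// lt_neqAle enorm_ge0 eq_sym ?u0 ?v0.
have := dotvv_ge0 (enorm v *: u - enorm u *: v).
rewrite !dotvE (dotvC v u) -!enorm_sqr => h.
have {}h : 0 <= 2 * (enorm u * enorm v) * (enorm u * enorm v - dotv u v) by lra.
by rewrite -subr_ge0 -(pmulr_rge0 _ uv0).
Qed.

Lemma dotv_le u v w : (forall i, 0 <= u 0 i) -> (forall i, v 0 i <= w 0 i) ->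
  dotv u v <= dotv u w.
Proof. by move=> u0 vw; apply: ler_sum => i _; rewrite ler_wpM2l. Qed.

Lemma enorm_row (c : 'I_n -> R) :
  enorm (\row_i c i) = Num.sqrt (\sum_(i < n) c i ^+ 2).
Proof. by congr Num.sqrt; apply: eq_bigr => i _; rewrite mxE. Qed.

Lemma enormB_sqr_le u v :
  enorm (u - v) ^+ 2 <= 2 * enorm u ^+ 2 + 2 * enorm v ^+ 2.
Proof.
by have := dotvv_ge0 (u + v); rewrite !enorm_sqr !dotvE (dotvC v u); lra.
Qed.

Lemma enorm_conv t u v w :
  enorm (t *: u + (1 - t) *: v - w) ^+ 2 =
  t * enorm (u - w) ^+ 2 + (1 - t) * enorm (v - w) ^+ 2
  - t * (1 - t) * enorm (u - v) ^+ 2.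
Proof.
by rewrite !enorm_sqr !dotvE (dotvC v u) (dotvC w u) (dotvC w v); ring.
Qed.

(* First-order optimality of a proximal step, strong convexity included:
   compare [xp] with [t x + (1 - t) xp] and let t tend to 0. *)
Lemma three_point (phi : 'rV[R]_n -> R) (l : R) (xh xp x : 'rV[R]_n) :
  0 <= l ->
  (forall t, 0 < t <= 1 ->
    phi xp + l / 2 * enorm (xp - xh) ^+ 2 <=
    t * phi x + (1 - t) * phi xp +
    l / 2 * enorm (t *: x + (1 - t) *: xp - xh) ^+ 2) ->
  phi xp + l / 2 * enorm (xp - xh) ^+ 2 + l / 2 * enorm (x - xp) ^+ 2 <=
  phi x + l / 2 * enorm (x - xh) ^+ 2.
Proof.
move=> l0 opt.
set q := l / 2 * enorm (x - xp) ^+ 2.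
have q0 : 0 <= q by rewrite mulr_ge0 ?divr_ge0 ?sqr_ge0.
apply/ler_addgt0Pr => e e0.
(* A quantitative form of letting t tend to 0: this [t] lies in (0, 1] and satisfies t q <= e, also
   when q = 0. *)
pose t := e / (e + q).
have eq0 : 0 < e + q by rewrite ltr_pwDl.
have t01 : 0 < t <= 1 by rewrite divr_gt0// ler_pdivrMr// mul1r lerDl.
have /andP[t0 _] := t01.
have tq : t * q <= e.
  by rewrite /t mulrAC ler_pdivrMr// ler_pM2l// lerDr ltW.
have := opt t t01; rewrite enorm_conv => h.
have {}h : t * (phi xp + l / 2 * enorm (xp - xh) ^+ 2 + q - t * q) <=
    t * (phi x + l / 2 * enorm (x - xh) ^+ 2) by rewrite /q; lra.
rewrite ler_pM2l// in h.
by rewrite (le_trans _ (lerD h tq))// subrK.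
Qed.

End EuclideanTheory.

Lemma dotv_mulmx (R : realType) (n m : nat) (y : 'rV[R]_m) (A : 'M[R]_(m, n))
  (x : 'rV[R]_n) : dotv (y *m A) x = dotv y (x *m A^T).
Proof.
rewrite /dotv; under eq_bigr do rewrite mxE mulr_suml.
rewrite exchange_big; apply: eq_bigr => i _; rewrite mxE mulr_sumr.
by apply: eq_bigr => j _; rewrite mxE; ring.
Qed.

(** * The step-size recursion and its O(1/k) rate *)

Section StepSizes.
Context {R : realType} {tau : nat -> R}.
Hypothesis tau1 : tau 1%N = 1.
Hypothesis tauS : forall k, (1 <= k)%N ->
  tau k.+1 = tau k / 2 * (Num.sqrt (tau k ^+ 2 + 4) - tau k).

(** The recursion selects the positive root s of s^2 + t^2 s - t^2 = 0, where t = [tau k]. *)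
Lemma tau_recursion k : (1 <= k)%N ->
  tau k.+1 ^+ 2 = (1 - tau k.+1) * tau k ^+ 2.
Proof.
move=> k1; rewrite (tauS k1).
have : Num.sqrt (tau k ^+ 2 + 4) ^+ 2 = tau k ^+ 2 + 4.
  by rewrite sqr_sqrtr// addr_ge0 ?sqr_ge0.
set s := Num.sqrt _; set t := tau k => s2.
have -> : (t / 2 * (s - t)) ^+ 2 = t ^+ 2 / 4 * (s ^+ 2 - 2 * s * t + t ^+ 2).
  by field.
by rewrite s2; field.
Qed.

Lemma tau_gt0 k : (1 <= k)%N -> 0 < tau k.
Proof.
elim: k => // -[_ _|k IH _]; first by rewrite tau1.
have tk := IH isT.
rewrite tauS// mulr_gt0 ?divr_gt0// subr_gt0.
rewrite -[ltLHS]gtr0_norm// -sqrtr_sqr ltr_sqrt ?ltrDl//.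
by rewrite addr_gt0// exprn_gt0.
Qed.

Lemma tau_le1 k : (1 <= k)%N -> tau k <= 1.
Proof.
case: k => // -[_|k _]; first by rewrite tau1.
have t2 : 0 < (1 - tau k.+2) * tau k.+1 ^+ 2.
  by rewrite -tau_recursion// exprn_gt0 ?tau_gt0.
by move: t2; rewrite pmulr_lgt0 ?exprn_gt0 ?tau_gt0// subr_gt0 => /ltW.
Qed.

(** The inverses a_k = 1 / tau_k satisfy (a_{k+1} - 1/2)^2 = a_k^2 + 1/4, so they grow by at least
    1/2 per step from a_1 = 1. *)
Lemma tau_le k : (1 <= k)%N -> tau k <= 2 / k.+1%:R.
Proof.
move=> k1; suff : k.+1%:R / 2 <= (tau k)^-1.
  rewrite -[leLHS]invrK lef_pV2 ?posrE ?invr_gt0 ?divr_gt0 ?tau_gt0//.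
  by rewrite invf_div.
elim: k k1 => // -[_ _|k IH _]; first by rewrite tau1 invr1 divff.
have := IH isT => {}IH.
have a0 : 0 < (tau k.+2)^-1 by rewrite invr_gt0 tau_gt0.
have b0 : 0 < (tau k.+1)^-1 by rewrite invr_gt0 tau_gt0.
have ab : (tau k.+2)^-1 ^+ 2 - (tau k.+2)^-1 = (tau k.+1)^-1 ^+ 2.
  have := tau_recursion (ltn0Sn k); have := @tau_gt0 k.+1 isT.
  have := @tau_gt0 k.+2 isT; move: (tau k.+2) (tau k.+1) => s t s0 t0 e.
  apply: (@mulfI _ (s ^+ 2 * t ^+ 2)).
    by rewrite mulf_neq0// expf_neq0// gt_eqF.
  transitivity ((1 - s) * t ^+ 2); first by field; rewrite gt_eqF.
  by rewrite -e; field; rewrite gt_eqF.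
have k3 : k.+3%:R = k.+2%:R + 1 :> R by rewrite -natr1.
(* This keeps a_{k+1} - 1/2 positive, so that the squaring below preserves the order. *)
have a1 : 1 < (tau k.+2)^-1.
  rewrite -subr_gt0 -(pmulr_rgt0 _ a0) mulrBr mulr1 -expr2 ab.
  by rewrite exprn_gt0.
suff : (tau k.+1)^-1 + 2^-1 <= (tau k.+2)^-1 by rewrite k3; lra.
rewrite leNgt; apply/negP => ba.
have : ((tau k.+2)^-1 - 2^-1) ^+ 2 < (tau k.+1)^-1 ^+ 2.
  by rewrite ltr_pXn2r ?nnegrE//; lra.
by rewrite -ab; lra.
Qed.

End StepSizes.

(** * Limiting subgradients and convexity along segments *)

Section Subgradients.
Context {R : realType} {n : nat}.
Implicit Types (X : set 'rV[R]_n) (x u v z : 'rV[R]_n).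

Section Limits.
Context {I : Type} {Fl : set_system I} {FF : Filter Fl}.
Implicit Types us vs : I -> 'rV[R]_n.

Lemma cvg_coord us u i : us @ Fl --> u -> (fun j => us j 0 i) @ Fl --> u 0 i.
Proof.
move=> uu; apply: (cvg_comp us (fun v => v 0 i) uu).
exact: (@coord_continuous R 1 n).
Qed.

Lemma cvg_dotv us vs u v : us @ Fl --> u -> vs @ Fl --> v ->
  (fun j => dotv (us j) (vs j)) @ Fl --> dotv u v.
Proof.
move=> uu vv; apply: (cvg_big (op := +%R)) => [|i _]; first exact: add_continuous.
by apply: cvgM; exact: cvg_coord.
Qed.

Lemma cvg_enorm us u : us @ Fl --> u ->
  (fun j => enorm (us j)) @ Fl --> enorm u.
Proof.
move=> uu; apply: (cvg_comp _ Num.sqrt); last exact: sqrt_continuous.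
apply: (cvg_big (op := +%R)) => [|i _]; first exact: add_continuous.
by apply: cvgM; exact: cvg_coord.
Qed.

End Limits.

(** At a point outside the relative interior, v is a limit of subgradients at u_j -> x. The
    Lipschitz bound replaces h(u_j) by h(x) - M |x - u_j|, and the inequality passes to the
    limit. *)
Lemma subdiff_subgradient X (h : 'rV[R]_n -> R) (M : R) x v :
  lipschitz_bound X h M -> subdiff X h x v -> subgradient X h x v.
Proof.
move=> hM [[] //|[Xx _ [us [vs [uvs uu vv]]]]] z Xz.
have hj j : h x + dotv (vs j) (z - us j) - M * enorm (x - us j) <= h z.
  have [[Xu _] _ hv] := uvs j.
  by have := hM _ _ Xx Xu; have := hv _ Xz; lra.
have lim : (fun j => h x + dotv (vs j) (z - us j) - M * enorm (x - us j)) @ \oo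
    --> h x + dotv v (z - x) - M * enorm (x - x).
  apply: cvgB.
    apply: cvgD; first exact: cvg_cst.
    by apply: cvg_dotv => //; apply: cvgB uu; exact: cvg_cst.
  apply: cvgM; first exact: cvg_cst.
  by apply: cvg_enorm; apply: cvgB uu; exact: cvg_cst.
rewrite subrr enorm0 mulr0 subr0 in lim.
by apply: (cvgr_to_le lim); apply: nearW => j; exact: hj.
Qed.

Lemma convex_set_segment X t u v :
  convex_set (X : set (convex_lmodType 'rV[R]_n)) ->
  X u -> X v -> 0 <= t <= 1 -> X (t *: u + (1 - t) *: v).
Proof.
move=> cX Xu Xv /andP[t0 t1].
have := cX u v (Itv01 t0 t1).
by rewrite !inE => /(_ Xu Xv).
Qed.

Lemma convex_function_segment X (h : 'rV[R]_n -> R) t u v :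
  convex_function (X : set (convex_lmodType 'rV[R]_n)) h ->
  X u -> X v -> 0 <= t <= 1 ->
  h (t *: u + (1 - t) *: v) <= t * h u + (1 - t) * h v.
Proof.
move=> ch Xu Xv /andP[t0 t1].
have := ch (Itv01 t0 t1) u v.
by rewrite !inE => /(_ Xu Xv).
Qed.

End Subgradients.

(** * Deterministic bound along one trajectory *)

Section DualStep.
Context {R : realType} {m : nat}.

(* The variational inequality of [s], tested at [0], [2 s] and [s - e_i]. *)
Lemma argmin_orthant (yt q s : 'rV[R]_m) (rho : R) : 0 < rho ->
  is_argmin [set s : 'rV[R]_m | forall i, s 0 i <= 0]
    (fun s => dotv (- yt) s + rho / 2 * enorm (q - s) ^+ 2) s ->
  (forall i, 0 <= (yt + rho *: (q - s)) 0 i) /\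
  dotv (yt + rho *: (q - s)) s = 0.
Proof.
move=> rho0 [/= s0 opt]; set y := yt + _.
have vi (s' : 'rV[R]_m) : (forall i, s' 0 i <= 0) -> dotv y (s' - s) <= 0.
  move=> s'0.
  have := @three_point R m (fun s => dotv (- yt) s) rho q s s' (ltW rho0).
  have h t : 0 < t <= 1 -> dotv (- yt) s + rho / 2 * enorm (s - q) ^+ 2 <=
      t * dotv (- yt) s' + (1 - t) * dotv (- yt) s +
      rho / 2 * enorm (t *: s' + (1 - t) *: s - q) ^+ 2.
    move=> /andP[t0 t1]; rewrite -!dotvZr -dotvDr.
    rewrite (enorm_distC s) (enorm_distC _ q); apply: opt => i /=.
    have ? := s0 i; have ? := s'0 i.
    by rewrite !mxE -[leRHS]addr0 lerD// mulr_ge0_le0 ?subr_ge0 ?(ltW t0).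
  move=> /(_ h); rewrite !enorm_sqr /y !dotvE.
  rewrite (dotvC q s) (dotvC q s') (dotvC s' s); lra.
split=> [i|]; last first.
  apply/eqP; rewrite eq_le; apply/andP; split.
    have /vi : forall i, (s + s) 0 i <= 0.
      by move=> i; rewrite mxE -[leRHS]addr0 lerD.
    by rewrite addrK.
  have /vi : forall i, (0 : 'rV[R]_m) 0 i <= 0 by move=> i; rewrite mxE.
  by rewrite sub0r dotvNr oppr_le0.
have /vi : forall j, (s - delta_mx 0 i) 0 j <= 0.
  by move=> j; rewrite !mxE subr_le0 (le_trans (s0 j))// ler0n.
rewrite addrC addKr dotvNr oppr_le0 /dotv (bigD1 i)//= big1 => [|j ji].
  by rewrite !mxE !eqxx mulr1 addr0.
by rewrite !mxE (negbTE ji) andbF mulr0.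
Qed.

End DualStep.

Lemma linearization_coord (R : realType) (n m : nat) (g : 'I_m -> 'rV[R]_n -> R)
    (g' : 'I_m -> 'rV[R]_n -> 'rV[R]_n) (xh x : 'rV[R]_n) (i : 'I_m) :
  linearization (fun x => \row_(i < m) g i x)
    (fun x => \matrix_(i < m) g' i x) xh x 0 i
  = g i xh + dotv (g' i xh) (x - xh).
Proof.
rewrite !mxE; congr (_ + _); apply: eq_bigr => j _.
by rewrite !mxE mulrC.
Qed.

(** * The one-step primal-dual inequality and its telescoping sum *)

Section Trajectory.
Context {R : realType} {n m : nat}.
Variables (X : set 'rV[R]_n) (f : 'rV[R]_n -> R) (chi0 : 'rV[R]_n -> \bar R).
Variables (g chi : 'I_m -> 'rV[R]_n -> R).
Variables (mu Lf Hf : R) (Lgi Hgi Mgi : 'I_m -> R).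
Variables (f' : 'rV[R]_n -> 'rV[R]_n) (g' : 'I_m -> 'rV[R]_n -> 'rV[R]_n).
Variables (xs : 'rV[R]_n) (B : R).

Let gv x : 'rV[R]_m := \row_(i < m) g i x.
Let chiv x : 'rV[R]_m := \row_(i < m) chi i x.
Let psi x : 'rV[R]_m := gv x + chiv x.
Let Gm x : 'M[R]_(m, n) := \matrix_(i < m) g' i x.
Let r xh x : 'rV[R]_m := linearization gv Gm xh x + chiv x.
Let D := half_diam X.
Let Lg := Num.sqrt (\sum_(i < m) Lgi i ^+ 2).
Let Hg := Num.sqrt (\sum_(i < m) Hgi i ^+ 2).
Let c0 x := fine (chi0 x).

Hypothesis convX : convex_set (X : set (convex_lmodType 'rV[R]_n)).
Hypothesis convchi0 : econvex_on X chi0.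
Hypothesis properchi0 : proper_on X chi0.
Hypothesis convg :
  forall i, convex_function (X : set (convex_lmodType 'rV[R]_n)) (g i).
Hypothesis convchi :
  forall i, convex_function (X : set (convex_lmodType 'rV[R]_n)) (chi i).
Hypothesis mu0 : 0 < mu.
Hypothesis sconvf : strongly_convex X f mu.
Hypothesis upf : upper_model X f Lf Hf.
Hypothesis upg : forall i, upper_model X (g i) (Lgi i) (Hgi i).
Hypothesis lipg : forall i, lipschitz_bound X (g i) (Mgi i).
Hypothesis f'P : forall z, X z -> subdiff X f z (f' z).
Hypothesis g'P : forall i z, X z -> subdiff X (g i) z (g' i z).
Hypothesis diamX : forall x y, X x -> X y -> enorm (x - y) <= 2 * D.

(** Each component obeys its upper model; Cauchy-Schwarz against the vectors of the constants [Lgi]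
    and [Hgi] then produces [Lg] and [Hg]. *)
Lemma linearization_error (y : 'rV[R]_m) xh x : (forall i, 0 <= y 0 i) ->
  X xh -> X x ->
  dotv y (gv x - linearization gv Gm xh x) <=
  enorm y * (Lg / 2 * enorm (x - xh) ^+ 2 + Hg * enorm (x - xh)).
Proof.
move=> y0 Xxh Xx; set d := enorm (x - xh).
have d0 : 0 <= d by exact: enorm_ge0.
pose ev : 'rV[R]_m := (d ^+ 2 / 2) *: (\row_i Lgi i) + d *: (\row_i Hgi i).
have : dotv y (gv x - linearization gv Gm xh x) <= dotv y ev.
  apply: dotv_le => // i; rewrite mxE [X in _ + X]mxE linearization_coord !mxE.
  have := upg Xx Xxh (g'P i Xxh); rewrite -/d; lra.
move=> /le_trans; apply.
rewrite dotvDr !dotvZr.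
have := cauchy_schwarz y (\row_i Lgi i); have := cauchy_schwarz y (\row_i Hgi i).
rewrite !enorm_row -/Lg -/Hg => h1 h2.
have := ler_wpM2l d0 h1.
have d20 : 0 <= d ^+ 2 / 2 by rewrite divr_ge0 ?sqr_ge0.
have := ler_wpM2l d20 h2; lra.
Qed.

Lemma fin_num_chi0 x v : X x -> (chi0 x <= v%:E)%E -> chi0 x \is a fin_num.
Proof.
move=> Xx xv; have [noo _] := properchi0; rewrite fin_numE noo//=.
by apply/eqP => xoo; move: xv; rewrite xoo.
Qed.

(** Comparison with a point where [chi0] is finite excludes +oo at the minimizer, so the
    inequalities at computed iterates can be read in R. *)
Lemma fin_num_prox (phi : 'rV[R]_n -> R) xp x :
  X x -> chi0 x \is a fin_num ->
  is_argmin X (fun x => (chi0 x + (phi x)%:E)%E) xp ->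
  chi0 xp \is a fin_num.
Proof.
move=> Xx finx [Xxp opt].
apply: (@fin_num_chi0 xp (c0 x + phi x - phi xp)) => //.
have := opt x Xx; rewrite -(fineK finx) -EFinD -/(c0 x).
by rewrite -leeBrDr.
Qed.

Lemma chi0_segment t u v : X u -> X v -> chi0 u \is a fin_num ->
  chi0 v \is a fin_num -> 0 <= t <= 1 ->
  chi0 (t *: u + (1 - t) *: v) \is a fin_num /\
  c0 (t *: u + (1 - t) *: v) <= t * c0 u + (1 - t) * c0 v.
Proof.
move=> Xu Xv finu finv t01.
have := convchi0 Xu Xv t01.
rewrite -(fineK finu) -(fineK finv) -!EFinM -EFinD => h.
have finw := fin_num_chi0 (convex_set_segment convX Xu Xv t01) h.
by split=> //; move: h; rewrite -(fineK finw) lee_fin.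
Qed.

(** [three_point] applies because y >= 0 makes <y, chi> convex. The conclusion is phrased with <y,
    r>, which differs from <y, chi> + <y G, .> by a constant in x. *)
Lemma prox_step (F xh xp w : 'rV[R]_n) (y : 'rV[R]_m) l :
  0 <= l -> (forall i, 0 <= y 0 i) -> X w -> chi0 w \is a fin_num ->
  is_argmin X (fun x => (chi0 x + (dotv y (chiv x) + dotv (F + y *m Gm xh) x
       + l / 2 * enorm (x - xh) ^+ 2)%:E)%E) xp ->
  c0 xp + dotv y (r xh xp) + dotv F xp + l / 2 * enorm (xp - xh) ^+ 2
    + l / 2 * enorm (w - xp) ^+ 2 <=
  c0 w + dotv y (r xh w) + dotv F w + l / 2 * enorm (w - xh) ^+ 2.
Proof.
move=> l0 y0 Xw finw opt.
have finxp := fin_num_prox Xw finw opt.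
have [Xxp {}opt] := opt.
pose phi x := c0 x + dotv y (chiv x) + dotv (F + y *m Gm xh) x.
have := @three_point R n phi l xh xp w l0.
have h t : 0 < t <= 1 -> phi xp + l / 2 * enorm (xp - xh) ^+ 2 <=
    t * phi w + (1 - t) * phi xp +
    l / 2 * enorm (t *: w + (1 - t) *: xp - xh) ^+ 2.
  move=> /andP[/ltW t0 t1]; have t01 : 0 <= t <= 1 by rewrite t0.
  set v := t *: w + _; have := opt v (convex_set_segment convX Xw Xxp t01).
  have [finv cv] := chi0_segment Xw Xxp finw finxp t01.
  rewrite /= -(fineK finxp) -(fineK finv) -!EFinD lee_fin -!/(c0 _) => {}opt.
  have : dotv y (chiv v) <= t * dotv y (chiv w) + (1 - t) * dotv y (chiv xp).
    rewrite -!dotvZr -dotvDr; apply: dotv_le => // i; rewrite !mxE.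
    exact: convex_function_segment.
  have : dotv (F + y *m Gm xh) v =
      t * dotv (F + y *m Gm xh) w + (1 - t) * dotv (F + y *m Gm xh) xp.
    by rewrite dotvDr !dotvZr.
  by move: opt cv; rewrite -/v /phi => {finv}; lra.
move=> /(_ h); rewrite /phi.
have rE x : dotv y (r xh x) = dotv y (chiv x) + dotv (y *m Gm xh) x
    + (dotv y (gv xh) - dotv (y *m Gm xh) xh).
  by rewrite /r /linearization !dotv_mulmx mulmxBl !dotvE; ring.
by rewrite !rE !(dotvDl F); lra.
Qed.

Hypothesis Lf0 : 0 <= Lf.
Hypothesis B0 : 0 <= B.
Hypothesis Xxs : X xs.
Hypothesis finxs : chi0 xs \is a fin_num.
Hypothesis feasxs : forall i, psi xs 0 i <= 0.

(** [Yb] bounds the norm of the multiplier. The values 0, |ys| + 1 and |ys| give the error constants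
    of the three estimates; the first one vanishes since B >= 0. *)
Let Hy Yb : R := Lg * D * Num.max (Yb - B) 0 + Hg * Yb.

(* Young's inequality against the strong convexity [mu / (2 t^2)] left over in
   the proximal term; the part of [yn Lg] exceeding [B Lg] is charged to the
   diameter. *)
Lemma noise_absorption (t d yn Yb de : R) : 0 < t -> 0 <= d <= 2 * D ->
  0 <= yn <= Yb -> 0 <= de ->
  yn * (Lg / 2 * d ^+ 2 + Hg * d) + de * d + (Lf / 2 * d ^+ 2 + Hf * d)
    - (Lf + B * Lg + mu / (2 * t ^+ 2)) * d ^+ 2 <=
  t ^+ 2 / mu * (Hy Yb ^+ 2 + 2 * (Hf ^+ 2 + de ^+ 2)).
Proof.
move=> t0 /andP[d0 dD] /andP[yn0 ynY] de0.
have Lg0 : 0 <= Lg := sqrtr_ge0 _.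
have Hg0 : 0 <= Hg := sqrtr_ge0 _.
have d20 : 0 <= d ^+ 2 := sqr_ge0 d.
have h1 : yn * (Lg / 2 * d ^+ 2 + Hg * d) <= Yb * (Lg / 2 * d ^+ 2 + Hg * d).
  by rewrite ler_wpM2r// addr_ge0 ?mulr_ge0// divr_ge0.
set p := Num.max (Yb - B) 0.
have p0 : 0 <= p by rewrite le_max lexx orbT.
have YBp : Yb <= B + p.
  by rewrite -lerBlDl le_max lexx.
have h2 : Yb * (Lg / 2 * d ^+ 2) <= (B + p) * (Lg / 2 * d ^+ 2).
  by rewrite ler_wpM2r// mulr_ge0// divr_ge0.
(* One factor d is traded for the diameter, which yields the linear coefficient Lg D p of [Hy]. *)
have h3 : p * Lg / 2 * d * d <= p * Lg / 2 * d * (2 * D).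
  by rewrite ler_wpM2l// !mulr_ge0// invr_ge0.
have LfB : 0 <= (Lf + B * Lg) / 2 * d ^+ 2.
  by rewrite mulr_ge0// divr_ge0// addr_ge0// mulr_ge0.
set c := Hy Yb + de + Hf.
have young : c * d - mu / (2 * t ^+ 2) * d ^+ 2 <= t ^+ 2 / (2 * mu) * c ^+ 2.
  rewrite -subr_ge0.
  have -> : t ^+ 2 / (2 * mu) * c ^+ 2 - (c * d - mu / (2 * t ^+ 2) * d ^+ 2) =
      mu / (2 * t ^+ 2) * (d - t ^+ 2 * c / mu) ^+ 2.
    by field; rewrite !gt_eqF.
  by rewrite mulr_ge0 ?sqr_ge0// divr_ge0 ?(ltW mu0)// mulr_ge0 ?sqr_ge0.
have c2 : c ^+ 2 <= 2 * (Hy Yb ^+ 2 + 2 * (Hf ^+ 2 + de ^+ 2)).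
  have := sqr_ge0 (Hy Yb - (de + Hf)); have := sqr_ge0 (de - Hf).
  by rewrite /c; lra.
have tm : 0 <= t ^+ 2 / (2 * mu) by rewrite divr_ge0 ?sqr_ge0// mulr_ge0// ltW.
have := ler_wpM2l tm c2.
have -> : t ^+ 2 / (2 * mu) * (2 * (Hy Yb ^+ 2 + 2 * (Hf ^+ 2 + de ^+ 2))) =
   t ^+ 2 / mu * (Hy Yb ^+ 2 + 2 * (Hf ^+ 2 + de ^+ 2)).
  by field; rewrite gt_eqF.
have cE : c * d = (Lg * D * p + Hg * Yb) * d + de * d + Hf * d.
  by rewrite /c /Hy -/p; ring.
by move: young; rewrite cE; lra.
Qed.

(** Converts the proximal distance to the moving test point t xs + (1 - t) x into the distance of an
    extrapolated point to the fixed xs; the latter can telescope. *)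
Lemma enorm_extrapolation (t : R) (a x : 'rV[R]_n) : t != 0 ->
  enorm (1 / t *: (a - (1 - t) *: x) - xs) ^+ 2 =
  enorm (t *: xs + (1 - t) *: x - a) ^+ 2 / t ^+ 2.
Proof.
move=> t0.
have -> : 1 / t *: (a - (1 - t) *: x) - xs
    = (- (1 / t)) *: (t *: xs + (1 - t) *: x - a).
  by apply/rowP => i; rewrite !mxE; field.
by rewrite !enorm_sqr dotvZl dotvZr; field.
Qed.

(** Adds the proximal inequality at w, the upper model of f at xp, strong convexity of f at xh
    towards xs and x with weights t and 1 - t, and the dual identity. The quadratic term towards xs
    is kept for the extrapolation, the one towards x is dropped. The alternative t = 1 covers a
    starting point where [chi0] is infinite. *)
Lemma primal_dual_step (t rho l Yb : R) (F x xh xp : 'rV[R]_n)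
    (y yk yp V s sp Vp : 'rV[R]_m) :
  let w := t *: xs + (1 - t) *: x in
  let gap x V := f x + c0 x + dotv y V - (f xs + c0 xs) in
  0 < t <= 1 -> 0 < rho -> l = 2 * (Lf + B * Lg) + mu / t ^+ 2 ->
  X x -> X xh -> t = 1 \/ chi0 x \is a fin_num ->
  (forall i, s 0 i <= 0) -> V = psi x - s ->
  is_argmin [set s : 'rV[R]_m | forall i, s 0 i <= 0]
    (fun s => dotv (- yk) s
       + rho / 2 * enorm (r xh xp - (1 - t) *: V - s) ^+ 2) sp ->
  is_argmin X (fun x => (chi0 x + (dotv yp (chiv x)
       + dotv (F + yp *m Gm xh) x + l / 2 * enorm (x - xh) ^+ 2)%:E)%E) xp ->
  yp = yk + rho *: (r xh xp - sp - (1 - t) *: V) ->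
  Vp = psi xp - sp ->
  (forall i, 0 <= y 0 i) -> enorm y <= Yb ->
  gap xp Vp + l / 2 * enorm (w - xp) ^+ 2 + 1 / (2 * rho) * enorm (y - yp) ^+ 2
  <= (1 - t) * gap x V + l / 2 * enorm (w - xh) ^+ 2
     - mu / 2 * t * enorm (xh - xs) ^+ 2 + 1 / (2 * rho) * enorm (y - yk) ^+ 2
     + dotv (F - f' xh) (w - xh)
     + t ^+ 2 / mu * (Hy Yb ^+ 2 + 2 * (Hf ^+ 2 + enorm (F - f' xh) ^+ 2)).
Proof.
move=> w gap /andP[t0 t1] rho0 lE Xx Xxh finx s0 VE sopt xopt ypE VpE y0 yY.
have Xxp : X xp by case: xopt.
have t01 : 0 <= t <= 1 by rewrite ltW.
have omt0 : 0 <= 1 - t by rewrite subr_ge0.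
have [yp0 compl] : (forall i, 0 <= yp 0 i) /\ dotv yp sp = 0.
  by rewrite ypE addrAC; exact: argmin_orthant.
have Xw : X w := convex_set_segment convX Xxs Xx t01.
have [finw cw] : chi0 w \is a fin_num /\ c0 w <= t * c0 xs + (1 - t) * c0 x.
  have [t11|finx'] := finx; last exact: chi0_segment.
  by rewrite /w t11 subrr scale1r scale0r addr0 mul1r mul0r addr0.
have l0 : 0 <= l.
  rewrite lE addr_ge0 ?divr_ge0 ?sqr_ge0 ?(ltW mu0)// mulr_ge0// addr_ge0//.
  by rewrite mulr_ge0// sqrtr_ge0.
have prox := prox_step l0 yp0 Xw finw xopt.
have fup := upf Xxp Xxh (f'P Xxh).
have fxs := sconvf Xxs Xxh (f'P Xxh).
have fx := sconvf Xx Xxh (f'P Xxh).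
(* Componentwise, r(xh, w) <= psi(w) <= t psi(xs) + (1 - t) psi(x) <= (1 - t) V: xs is feasible, and
   psi(x) = V + s with s <= 0. *)
have rw : dotv yp (r xh w) <= (1 - t) * dotv yp V.
  rewrite -dotvZr; apply: dotv_le => // i.
  have : r xh w 0 i <= psi w 0 i.
    rewrite mxE linearization_coord [leRHS]mxE lerD2r [leRHS]mxE.
    exact: (subdiff_subgradient (@lipg i) (g'P i Xxh)).
  have gw := convex_function_segment (@convg i) Xxs Xx t01.
  have chiw := convex_function_segment (@convchi i) Xxs Xx t01.
  have := ler_wpM2l (ltW t0) (feasxs i); have := ler_wpM2l omt0 (s0 i).
  by move: gw chiw; rewrite VE !mxE -/w; lra.
set q := r xh xp - sp - (1 - t) *: V in ypE.
(* Expanding the squares with y - yp = (y - yk) - rho q leaves exactly the slack rho |q|^2 / 2. *)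
have dual : dotv (y - yp) q <=
    1 / (2 * rho) * (enorm (y - yk) ^+ 2 - enorm (y - yp) ^+ 2).
  have -> : y - yp = y - yk - rho *: q by rewrite ypE opprD addrA.
  rewrite !enorm_sqr !(dotvBl _ (rho *: q)) !(dotvBr _ _ (rho *: q)).
  rewrite !dotvZl !dotvZr (dotvC q); set a := dotv (y - yk) _.
  rewrite -subr_ge0 (_ : _ - _ = rho / 2 * dotv q q); last first.
    by rewrite /a; field; rewrite gt_eqF.
  by rewrite mulr_ge0 ?dotvv_ge0// divr_ge0// ltW.
have dxp := diamX Xxp Xxh.
have err := linearization_error y0 Xxh Xxp.
have noise := cauchy_schwarz (F - f' xh) (xh - xp).
rewrite (enorm_distC xh) in noise.
have := @noise_absorption t (enorm (xp - xh)) (enorm y) Yb (enorm (F - f' xh)) t0.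
rewrite dxp !enorm_ge0 yY => /(_ isT isT isT) absorb.
(* V_{k+1} evaluates g itself and \tilde V_{k+1} its linearization; the difference is the error
   bounded in [err]. *)
have VpE' : Vp = q + (1 - t) *: V + (gv xp - linearization gv Gm xh xp).
  rewrite VpE /q /psi /r; set lin := linearization _ _ _ _.
  by apply/rowP => i; rewrite !mxE; ring.
have dq : dotv yp (r xh xp) = dotv yp q + (1 - t) * dotv yp V.
  by rewrite /q !dotvBr compl dotvZr; ring.
have l2 : l / 2 = Lf + B * Lg + mu / (2 * t ^+ 2).
  by rewrite lE; field; rewrite gt_eqF.
have wE : dotv (f' xh) w = t * dotv (f' xh) xs + (1 - t) * dotv (f' xh) x.
  by rewrite dotvDr !dotvZr.
have mux : 0 <= mu / 2 * (1 - t) * enorm (x - xh) ^+ 2.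
  by rewrite mulr_ge0 ?sqr_ge0// mulr_ge0// divr_ge0// ltW.
have fx' := ler_wpM2l omt0 fx; have fxs' := ler_wpM2l (ltW t0) fxs.
clearbody q.
rewrite /gap VpE' (dotvDr y _ (gv xp - _)) (dotvDr y q) dotvZr (enorm_distC xh xs).
move: prox dual noise absorb fup fx' fxs' rw err cw mux.
rewrite dq l2 !dotvBl !dotvBr wE; lra.
Qed.

(* [u = (xh - (1 - t) x) / t] is the convex combination of [z] and [xh] with
   weights [l0 / l] and [mu / (t l)]. *)
Lemma extrapolation_bound (t0 t l0 l : R) (x0 x : 'rV[R]_n) :
  let beta := (1 - t0) * t0 * l0 / (t0 ^+ 2 * l0 + l * t) in
  let xh := x + beta *: (x - x0) in
  0 < t0 -> 0 < t <= 1 -> t ^+ 2 = (1 - t) * t0 ^+ 2 -> 0 < l0 ->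
  l = l0 + mu / t ->
  l / 2 * enorm (t *: xs + (1 - t) *: x - xh) ^+ 2 / t ^+ 2
    - mu / (2 * t) * enorm (xh - xs) ^+ 2 <=
  l0 / 2 * enorm (1 / t0 *: (x - (1 - t0) *: x0) - xs) ^+ 2.
Proof.
move=> beta xh t00 /andP[tp t1] tt l00 lE.
have l_gt0 : 0 < l by rewrite lE addr_gt0// divr_gt0.
have muE : t * (l - l0) = mu by rewrite lE; field; rewrite gt_eqF.
(* The relations t^2 = (1 - t) t0^2 and mu = t (l - l0) collapse the denominator of [beta]. *)
have den : t * (t0 ^+ 2 * l0 + l * t) = t0 ^+ 2 * (l - mu).
  rewrite -muE; transitivity (t * t0 ^+ 2 * l0 + l * t ^+ 2); first by ring.
  by rewrite tt; ring.
have den0 : 0 < t0 ^+ 2 * l0 + l * t.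
  by rewrite addr_gt0 ?mulr_gt0// exprn_gt0.
have lmu0 : 0 < l - mu.
  by rewrite -(pmulr_rgt0 _ (exprn_gt0 2 t00)) -den mulr_gt0.
have betaE : beta = (1 - t0) * l0 * t / (t0 * (l - mu)).
  have -> : l - mu = t * (t0 ^+ 2 * l0 + l * t) / t0 ^+ 2.
    by rewrite den; field; rewrite gt_eqF.
  by rewrite /beta; field; rewrite !gt_eqF.
pose z := 1 / t0 *: (x - (1 - t0) *: x0); rewrite -/z.
pose u := 1 / t *: (xh - (1 - t) *: x).
pose la := l0 / l.
have uE : u = la *: z + (1 - la) *: xh.
  apply/rowP => i; rewrite !mxE /la betaE -muE; field.
  by rewrite muE !gt_eqF.
rewrite -mulrA -enorm_extrapolation ?gt_eqF// -/u uE enorm_conv.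
have la01 : 0 <= la * (1 - la).
  rewrite mulr_ge0 ?divr_ge0 ?(ltW l00) ?(ltW l_gt0)// subr_ge0 ler_pdivrMr// mul1r.
  by rewrite lE lerDl ltW// divr_gt0.
have h := mulr_ge0 (mulr_ge0 (ltW l_gt0) la01) (sqr_ge0 (enorm (z - xh))).
have e1 : l / 2 * la = l0 / 2 by rewrite /la; field; rewrite gt_eqF.
have e2 : l / 2 * (1 - la) = mu / (2 * t).
  by rewrite /la -muE; field; rewrite !gt_eqF.
set a := enorm (z - xs) ^+ 2; set b := enorm (xh - xs) ^+ 2.
set c := enorm (z - xh) ^+ 2 in h *.
have -> : l / 2 * (la * a + (1 - la) * b - la * (1 - la) * c) =
    (l / 2 * la) * a + (l / 2 * (1 - la)) * b - 2^-1 * (l * (la * (1 - la)) * c).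
  by field.
by rewrite e1 e2; lra.
Qed.

Variables (rho eta L tau beta : nat -> R) (K : nat).
Variables (x1 : 'rV[R]_n) (y1 : 'rV[R]_m) (sg : nat -> 'rV[R]_n).
Variables (it : iterates R n m) (M : R).
Hypothesis tau1 : tau 1%N = 1.
Hypothesis tauS : forall k, (1 <= k)%N ->
  tau k.+1 = tau k / 2 * (Num.sqrt (tau k ^+ 2 + 4) - tau k).
Hypothesis M0 : 0 < M.
Hypothesis rho1E : rho 1%N = mu / (2 * M ^+ 2).
Hypothesis rhoS : forall k, (1 <= k)%N -> rho k.+1 = rho 1%N / tau k.+1 ^+ 2.
Hypothesis etaE : forall k, (1 <= k)%N -> eta k = rho k.
Hypothesis betaS : forall k, (1 <= k)%N ->
  beta k.+1 = (1 - tau k) * tau k * L k / (tau k ^+ 2 * L k + L k.+1 * tau k.+1).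
Hypothesis LE : forall k, (1 <= k)%N ->
  L k = 2 * (Lf + B * Lg + rho k * M ^+ 2).
Hypothesis Xx1 : X x1.
Hypothesis run : aug_conex X chi0 gv chiv Gm rho eta L tau beta K x1 y1 sg it.
Hypothesis Xxh : forall k, (1 <= k < K)%N -> X (it_xh it k).

Lemma rho1_gt0 : 0 < rho 1%N.
Proof. by rewrite rho1E divr_gt0// mulr_gt0// exprn_gt0. Qed.

Lemma rho_tau k : (1 <= k)%N -> rho k = rho 1%N / tau k ^+ 2.
Proof. by case: k => [//|[_|k _]]; rewrite ?tau1 ?expr1n ?divr1// rhoS. Qed.

(** The value of rho_1 is chosen so that 2 rho_k M^2 = mu / tau_k^2; half of this is the budget
    spent in [noise_absorption]. *)
Lemma L_tau k : (1 <= k)%N -> L k = 2 * (Lf + B * Lg) + mu / tau k ^+ 2.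
Proof.
move=> k1; rewrite LE// rho_tau// rho1E; field.
by rewrite !gt_eqF// (tau_gt0 tau1 tauS).
Qed.

Lemma L_tau_gt0 k : (1 <= k)%N -> 0 < L k.
Proof.
move=> k1; rewrite L_tau// ltr_wpDl ?divr_gt0 ?exprn_gt0 ?(tau_gt0 tau1 tauS)//.
by rewrite mulr_ge0// addr_ge0// mulr_ge0// sqrtr_ge0.
Qed.

(* [chi0 x1] may be infinite; this is harmless because [tau 1 = 1] removes [x1]
   from the first step. *)
Lemma iterates_invariant k : (1 <= k <= K)%N ->
  [/\ X (it_x it k), it_yt it k = it_y it k, forall i, it_s it k 0 i <= 0,
      it_V it k = psi (it_x it k) - it_s it k &
      k = 1%N \/ chi0 (it_x it k) \is a fin_num].
Proof.
have [[x1E [y1E [xh1E [yt1E [s1E V1E]]]]] stp] := run.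
case: k => // -[_|k /andP[_ kK]].
  rewrite x1E y1E yt1E s1E V1E subr0; split=> //; last by left.
  by move=> i; rewrite mxE.
have [[s0 _] [xopt [_ [yE [VE [ytE _]]]]]] := stp k.+1 kK.
rewrite yE ytE etaE// VE; split=> //; first by case: xopt.
by right; exact: (fin_num_prox Xxs finxs xopt).
Qed.

(** The random part of the one-step bound after division by tau_k^2; this division turns 2 tau_k^2 /
    mu into 2 / mu. *)
Let noise k : R :=
  dotv (sg k - f' (it_xh it k))
       (tau k *: xs + (1 - tau k) *: it_x it k - it_xh it k) / tau k ^+ 2
  + 2 / mu * enorm (sg k - f' (it_xh it k)) ^+ 2.

Lemma iterates_bound (y : 'rV[R]_m) Yb k : (1 <= k < K)%N ->
  (forall i, 0 <= y 0 i) -> enorm y <= Yb ->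
  (f (it_x it k.+1) + c0 (it_x it k.+1) + dotv y (it_V it k.+1)
     - (f xs + c0 xs)) / tau k ^+ 2
  + L k / 2 * enorm (1 / tau k *: (it_x it k.+1 - (1 - tau k) *: it_x it k) - xs)
      ^+ 2
  + 1 / (2 * rho 1%N) * enorm (y - it_y it k.+1) ^+ 2 <=
  (Lf + B * Lg) * enorm (x1 - xs) ^+ 2
  + 1 / (2 * rho 1%N) * enorm (y - y1) ^+ 2
  + \sum_(1 <= j < k.+1) noise j + k%:R * ((Hy Yb ^+ 2 + 2 * Hf ^+ 2) / mu).
Proof.
move=> k1K y0 yY.
pose gap k := f (it_x it k) + c0 (it_x it k) + dotv y (it_V it k)
     - (f xs + c0 xs).
have step j : (1 <= j < K)%N ->
  gap j.+1 / tau j ^+ 2 + L j / 2 *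
    enorm (1 / tau j *: (it_x it j.+1 - (1 - tau j) *: it_x it j) - xs) ^+ 2
  + 1 / (2 * rho 1%N) * enorm (y - it_y it j.+1) ^+ 2 <=
  (1 - tau j) / tau j ^+ 2 * gap j
  + (L j / 2 * enorm (tau j *: xs + (1 - tau j) *: it_x it j - it_xh it j) ^+ 2
       / tau j ^+ 2
     - mu / (2 * tau j) * enorm (it_xh it j - xs) ^+ 2)
  + 1 / (2 * rho 1%N) * enorm (y - it_y it j) ^+ 2
  + noise j + (Hy Yb ^+ 2 + 2 * Hf ^+ 2) / mu.
  move=> jK; have /andP[j1 ltjK] := jK.
  have jK' : (1 <= j <= K)%N by rewrite j1 ltnW.
  have [Xj ytj sj Vj finj] := iterates_invariant jK'.
  have [_ /(_ j jK)[sopt [xopt [VtE [yE [VE _]]]]]] := run.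
  have t0 : 0 < tau j by exact: tau_gt0 tau1 tauS _ _.
  have t01 : 0 < tau j <= 1 by rewrite t0 (tau_le1 tau1 tauS).
  have rhoj : 0 < rho j by rewrite rho_tau// divr_gt0 ?rho1_gt0 ?exprn_gt0.
  have finj' : tau j = 1 \/ chi0 (it_x it j) \is a fin_num.
    by case: finj => [->|]; [left|right].
  rewrite ytj in sopt yE; rewrite VtE in yE.
  have := primal_dual_step t01 rhoj (L_tau j1) Xj (Xxh jK) finj' sj Vj sopt xopt
    yE VE y0 yY.
  have t2 : 0 <= (tau j ^+ 2)^-1 by rewrite invr_ge0 sqr_ge0.
  move=> /(ler_wpM2l t2); rewrite enorm_extrapolation ?gt_eqF// rho_tau//.
  rewrite -/(gap j) -/(gap j.+1) /noise.
  set del := enorm (sg j - _); set dt := dotv (sg j - _) _.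
  rewrite -subr_ge0 => h; rewrite -subr_ge0; move: h; congr (0 <= _).
  by field; rewrite !gt_eqF// rho1_gt0.
have [[x1E [y1E [xh1E _]]] stp] := run.
elim: k k1K => // -[_ /step|k IH kK].
  (* In the first step tau_1 = 1 removes the gap at x1, and L_1 / 2 - mu / 2 = Lf + B Lg is the
     coefficient of |x1 - xs|^2. *)
  rewrite x1E y1E xh1E tau1 subrr scale1r scale0r addr0 big_nat1 L_tau// tau1.
  rewrite (enorm_distC xs).
  move=> /le_trans; apply.
  by rewrite !expr1n !divr1 !mulr1 !mul0r add0r mul1r; lra.
have tk1 : 0 < tau k.+1 by exact: tau_gt0 tau1 tauS _ _.
have tk2 : 0 < tau k.+2 by exact: tau_gt0 tau1 tauS _ _.
have kK' : (1 <= k.+1 < K)%N by case/andP: kK => _ /ltnW.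
have rec := tau_recursion tauS (ltn0Sn k).
have omt : 1 - tau k.+2 != 0.
  by apply/eqP => h; have := exprn_gt0 2 tk2; rewrite rec h mul0r ltxx.
have tinv : (1 - tau k.+2) / tau k.+2 ^+ 2 = (tau k.+1 ^+ 2)^-1.
  by rewrite rec invfM mulrA divff// mul1r.
have LL : L k.+2 = L k.+1 + mu / tau k.+2.
  by rewrite !L_tau// -tinv; field; rewrite gt_eqF.
have t01 : 0 < tau k.+2 <= 1 by rewrite tk2 (tau_le1 tau1 tauS).
have := extrapolation_bound (it_x it k.+1) (it_x it k.+2) tk1 t01 rec
  (L_tau_gt0 (ltn0Sn k)) LL.
rewrite -betaS//.
have [_ [_ [_ [_ [_ [_ <-]]]]]] := stp _ kK'.
move=> ext; have := IH kK'; have := step _ kK.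
rewrite tinv.
rewrite (@big_nat_recr _ _ _ k.+2)//= -(natr1 k.+1) -/(gap k.+2) -/(gap k.+3).
lra.
Qed.

End Trajectory.

(** * Independence and the oracle noise *)

Section Integral.
Context d (T : measurableType d) (R : realType).
Variable mu : {measure set T -> \bar R}.
Local Open Scope ereal_scope.
Import HBNNSimple.

(* Measurability plays no role: the integral is defined from suprema of
   integrals of simple functions. *)
Lemma le_integral_pointwise (f g : T -> \bar R) : (forall x, f x <= g x) ->
  \int[mu]_x f x <= \int[mu]_x g x.
Proof.
move=> fg; have ge0 (u v : T -> \bar R) : (forall x, 0 <= u x) ->
    (forall x, u x <= v x) -> \int[mu]_x u x <= \int[mu]_x v x.
  move=> u0 uv; rewrite !ge0_integralTE//.
    apply: ereal_sup_le => _ [h hu <-]; exists h => //= x.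
    exact: le_trans (hu x) (uv x).
  by move=> x; exact: le_trans (u0 x) (uv x).
rewrite integralE [leRHS]integralE; apply: leeB; apply: ge0 => // x.
  by rewrite !funeposE ge_max !le_max fg lexx orbT.
by rewrite !funenegE ge_max !le_max leeN2 fg lexx orbT.
Qed.

End Integral.

Section ProbabilityIntegral.
Context d (T : measurableType d) (R : realType) (P : probability T R).
Local Open Scope ereal_scope.

Lemma integral_probability_cst (r : \bar R) : \int[P]_x r = r.
Proof. by rewrite -[RHS]mule1 -(probability_setT P) -integral_cst. Qed.

Lemma integral_probability_le (f : T -> \bar R) (r : \bar R) :
  (forall x, f x <= r) -> \int[P]_x f x <= r.
Proof.
move=> fr; rewrite -[leRHS]integral_probability_cst.
exact: le_integral_pointwise.
Qed.

End ProbabilityIntegral.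

Section Independence.
Context d d1 d2 (T : measurableType d) (T1 : measurableType d1)
  (T2 : measurableType d2) (R : realType).
Variables (P : probability T R) (Z : {RV P >-> T1}) (xi : {RV P >-> T2}).
Hypothesis indep : forall A E, measurable A -> measurable E ->
  P ((xi @^-1` E) `&` (Z @^-1` A)) = (P (xi @^-1` E) * P (Z @^-1` A))%E.
Local Open Scope ereal_scope.

Let pair w := (Z w, xi w).

Lemma measurable_pairRV : measurable_fun setT pair.
Proof. exact: measurable_fun_pair. Qed.

HB.instance Definition _ := @isMeasurableFun.Build _ _ T (T1 * T2)%type pair
  measurable_pairRV.

(** Independence makes the joint law and the product law agree on rectangles, and these determine
    the product measure. *)
Lemma distribution_pair A : measurable A ->
  (distribution P Z \x distribution P xi) A = distribution P pair A.
Proof.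
apply: (@product_measure_unique _ _ _ _ _ (distribution P Z) (distribution P xi)).
move=> B E mB mE; rewrite muleC -[RHS]indep// /distribution /pushforward.
congr (P _); rewrite setIC; apply/seteqP.
by split=> w [].
Qed.

Lemma ge0_integral_pair (f : T1 * T2 -> \bar R) : measurable_fun [set: T1 * T2] f ->
  (forall z, 0 <= f z) ->
  \int[P]_w f (Z w, xi w) =
  \int[distribution P Z]_z \int[distribution P xi]_e f (z, e).
Proof.
move=> mf f0; transitivity (\int[distribution P Z \x distribution P xi]_z f z).
  transitivity (\int[distribution P pair]_z f z).
    by rewrite ge0_integral_distribution.
  by apply/esym/eq_measure_integral => A mA _; exact: distribution_pair.
exact: fubini_tonelli1.
Qed.

Lemma integral_pair (f : T1 * T2 -> \bar R) : measurable_fun [set: T1 * T2] f ->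
  P.-integrable setT (fun w => f (Z w, xi w)) ->
  \int[P]_w f (Z w, xi w) =
  \int[distribution P Z]_z \int[distribution P xi]_e f (z, e).
Proof.
move=> mf intf; transitivity (\int[distribution P Z \x distribution P xi]_z f z).
  transitivity (\int[distribution P pair]_z f z).
    by rewrite integral_distribution.
  by apply/esym/eq_measure_integral => A mA _; exact: distribution_pair.
(* Integrability for the product law is transported from that of the composite under [P]. *)
rewrite -integral12_prod_meas1//; apply/integrableP; split=> //.
have mabs : measurable_fun [set: T1 * T2] (abse \o f) by exact: measurableT_comp.
have /integrableP[_] := intf; apply: le_lt_trans.
rewrite le_eqVlt; apply/orP; left; apply/eqP.
transitivity (\int[distribution P pair]_z `|f z|).
  by apply/eq_measure_integral => A mA _; exact: distribution_pair.
by rewrite ge0_integral_distribution.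
Qed.

End Independence.

Lemma measurable_dotv d (T : measurableType d) (R : realType) n (D : set T)
    (u v : T -> 'rV[R]_n) :
  (forall i, measurable_fun D (fun w => u w 0 i)) ->
  (forall i, measurable_fun D (fun w => v w 0 i)) ->
  measurable_fun D (fun w => dotv (u w) (v w)).
Proof. by move=> mu mv; apply: measurable_sum => i; exact: measurable_funM. Qed.

(** * Mean and variance of the oracle at a random query point *)

Section OracleNoise.
Context d d1 d2 (T : measurableType d) (T1 : measurableType d1)
  (T2 : measurableType d2) (R : realType) (n : nat).
Variables (P : probability T R) (Z : {RV P >-> T1}) (xi : {RV P >-> T2}).
Hypothesis indep : forall A E, measurable A -> measurable E ->
  P ((xi @^-1` E) `&` (Z @^-1` A)) = (P (xi @^-1` E) * P (Z @^-1` A))%E.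
Variables (Phi : T1 -> T2 -> 'rV[R]_n) (mean q : T1 -> 'rV[R]_n) (sigma C : R).
Hypothesis mPhi : forall i,
  measurable_fun [set: T1 * T2] (fun p => Phi p.1 p.2 0 i).
Hypothesis mq : forall i, measurable_fun setT (fun z => q z 0 i).
Hypothesis qC : forall z, enorm (q z) <= C.
Hypothesis meanE : forall z i,
  (\int[P]_w (Phi z (xi w) 0 i)%:E)%E = (mean z 0 i)%:E.
Hypothesis varE : forall z,
  (\int[P]_w (enorm (Phi z (xi w) - mean z) ^+ 2)%:E <= (sigma ^+ 2)%:E)%E.

Let mPhi1 z i : measurable_fun setT (fun e => Phi z e 0 i).
Proof.
exact: (measurableT_comp (mPhi i) (measurable_pair1 z)).
Qed.

Let mean_integral z i :
  (mean z 0 i)%:E = (\int[distribution P xi]_e (Phi z e 0 i)%:E)%E.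
Proof.
rewrite -meanE [LHS]integralE [RHS]integralE.
have mf : measurable_fun setT (fun e => (Phi z e 0 i)%:E).
  exact/measurable_EFinP.
rewrite !ge0_integral_distribution//.
- by congr (_ - _)%E; apply: eq_integral => w _; rewrite /= ?funeposE ?funenegE.
- exact: measurable_funeneg.
- exact: measurable_funepos.
Qed.

(** Measurability of the selected subgradient is derived: it is the sample integral of a jointly
    measurable map, handled by Tonelli on positive and negative parts. *)
Lemma measurable_mean i : measurable_fun setT (fun z => mean z 0 i).
Proof.
apply/measurable_EFinP.
have -> : EFin \o (fun z => mean z 0 i) = (fun z =>
    fubini_F (distribution P xi) (fun p => (Phi p.1 p.2 0 i)%:E)^\+ z
    - fubini_F (distribution P xi) (fun p => (Phi p.1 p.2 0 i)%:E)^\- z)%E.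
  apply/funext => z; rewrite /= mean_integral integralE /fubini_F.
  by congr (_ - _)%E; apply: eq_integral => w _; rewrite /= ?funeposE ?funenegE.
have mf : measurable_fun [set: T1 * T2] (fun p => (Phi p.1 p.2 0 i)%:E).
  exact/measurable_EFinP.
apply: emeasurable_funB; apply: measurable_fun_fubini_tonelli_F => //.
  exact: measurable_funepos.
exact: measurable_funeneg.
Qed.

Let Del (p : T1 * T2) := Phi p.1 p.2 - mean p.1.

Let mDel i : measurable_fun [set: T1 * T2] (fun p => Del p 0 i).
Proof.
under eq_fun do rewrite !mxE.
apply: measurable_funB => //.
exact: (measurableT_comp (measurable_mean i) measurable_fst).
Qed.

Let mDel2 : measurable_fun [set: T1 * T2] (fun p => enorm (Del p) ^+ 2).
Proof. by under eq_fun do rewrite enorm_sqr; exact: measurable_dotv. Qed.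

Let mpair : measurable_fun [set: T] (fun w => (Z w, xi w)).
Proof. exact: measurable_fun_pair. Qed.

Let var_integral z :
  (\int[distribution P xi]_e (enorm (Del (z, e)) ^+ 2)%:E <= (sigma ^+ 2)%:E)%E.
Proof.
rewrite ge0_integral_distribution//; first exact: varE.
  apply/measurable_EFinP.
  exact: (measurableT_comp mDel2 (measurable_pair1 z)).
by move=> e; rewrite lee_fin sqr_ge0.
Qed.

Lemma oracle_variance :
  (\int[P]_w (enorm (Phi (Z w) (xi w) - mean (Z w)) ^+ 2)%:E
     <= (sigma ^+ 2)%:E)%E.
Proof.
rewrite (ge0_integral_pair indep (f := fun p => (enorm (Del p) ^+ 2)%:E)).
- exact: integral_probability_le.
- exact/measurable_EFinP.
- by move=> z; rewrite lee_fin sqr_ge0.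
Qed.

Lemma integrable_oracle_variance :
  P.-integrable setT
    (fun w => (enorm (Phi (Z w) (xi w) - mean (Z w)) ^+ 2)%:E).
Proof.
apply/integrableP; split.
  by apply/measurable_EFinP; exact: (measurableT_comp mDel2 mpair).
under eq_integral do rewrite gee0_abs ?lee_fin ?sqr_ge0//.
by apply: le_lt_trans oracle_variance _; rewrite ltry.
Qed.

(** Cauchy-Schwarz and |q| <= C dominate the product by |Del|^2 + C^2. *)
Lemma integrable_oracle_bias :
  P.-integrable setT
    (fun w => (dotv (Phi (Z w) (xi w) - mean (Z w)) (q (Z w)))%:E).
Proof.
apply: (@le_integrable _ _ _ _ _ _ _
  (fun w => (enorm (Del (Z w, xi w)) ^+ 2)%:E + (cst (C ^+ 2) w)%:E)%E) => //.
- apply/measurable_EFinP; apply: measurable_dotv => i.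
    exact: (measurableT_comp (mDel i) mpair).
  exact: (measurableT_comp (mq i)).
- move=> w _; rewrite -EFinD !lee_fin /=; set u := _ - _; set v := q _.
  rewrite [leRHS]ger0_norm ?addr_ge0 ?sqr_ge0//.
  have uv (a b : 'rV[R]_n) : enorm b <= C -> dotv a b <= enorm a ^+ 2 + C ^+ 2.
    move=> bC; apply: le_trans (cauchy_schwarz a b) _.
    have := sqr_ge0 (enorm a - enorm b); have := enorm_ge0 b.
    by have := sqr_ge0 (enorm a + enorm b); nra.
  have vC : enorm v <= C := qC _.
  rewrite ler_norml lerNl -dotvNl (uv u v)// andbT.
  have eN : enorm (- u) ^+ 2 = enorm u ^+ 2.
    by rewrite !enorm_sqr dotvNl dotvNr opprK.
  by rewrite -eN uv.
- apply: integrableD => //; first exact: integrable_oracle_variance.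
  exact: finite_measure_integrable_cst.
Qed.

(** Domination by the integrable |Del|^2 + 1, through |a| <= a^2 + 1. *)
Let integrable_Del z i :
  (distribution P xi).-integrable setT (fun e => (Del (z, e) 0 i)%:E).
Proof.
apply: (@le_integrable _ _ _ _ _ _ _
  (fun e => (enorm (Del (z, e)) ^+ 2)%:E + (cst 1 e)%:E)%E) => //.
- by apply/measurable_EFinP; exact: (measurableT_comp (mDel i) (measurable_pair1 z)).
- move=> e _; rewrite -EFinD !lee_fin /=; set u := Del _.
  rewrite [leRHS]ger0_norm ?addr_ge0 ?sqr_ge0//.
  have ui : u 0 i ^+ 2 <= enorm u ^+ 2.
    rewrite enorm_sqr /dotv (bigD1 i)//= -expr2 lerDl.
    by apply: sumr_ge0 => j _; rewrite -expr2 sqr_ge0.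
  apply: le_trans (lerD ui (lexx 1)).
  by rewrite -real_normK ?num_real//; have := sqr_ge0 (`|u 0 i| - 1); nra.
- apply: integrableD => //; last exact: finite_measure_integrable_cst.
  apply/integrableP; split.
    by apply/measurable_EFinP; exact: (measurableT_comp mDel2 (measurable_pair1 z)).
  under eq_integral do rewrite gee0_abs ?lee_fin ?sqr_ge0//.
  by apply: le_lt_trans (var_integral z) _; rewrite ltry.
Qed.

Let integral_Del z i :
  (\int[distribution P xi]_e (Del (z, e) 0 i)%:E = 0)%E.
Proof.
have := mean_integral z i.
rewrite (eq_integral (fun e => (Del (z, e) 0 i)%:E + (cst (mean z 0 i) e)%:E)%E).
  rewrite integralD//=; last exact: finite_measure_integrable_cst.
  rewrite integral_probability_cst -(fineK (integrable_fin_num _ (integrable_Del z i)))//.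
  by rewrite -EFinD => -[h]; congr EFin; lra.
by move=> e _; rewrite -EFinD /Del !mxE subrK.
Qed.

Lemma oracle_unbiased :
  (\int[P]_w (dotv (Phi (Z w) (xi w) - mean (Z w)) (q (Z w)))%:E = 0)%E.
Proof.
rewrite (integral_pair indep (f := fun p => (dotv (Del p) (q p.1))%:E)).
- apply: integral0_eq => z _.
  have Deli i := integrable_Del z i.
  under eq_integral do rewrite /dotv -sumEFin.
  rewrite integral_sum//=; last first.
    by move=> i; under eq_fun do rewrite EFinM; exact: integrableZr.
  rewrite big1// => i _; under eq_integral do rewrite EFinM.
  by rewrite integralZr// integral_Del mul0e.
- apply/measurable_EFinP; apply: measurable_dotv => // i.
  exact: (measurableT_comp (mq i) measurable_fst).
- exact: integrable_oracle_bias.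
Qed.

End OracleNoise.

(** * Measurability *)

Section Diameter.
Context {R : realType} {n : nat}.
Variable X : set 'rV[R]_n.
Hypothesis compactX : compact X.

(** A supremum bounds its set only when the set is bounded above; compactness bounds every
    coordinate, hence all distances. *)
Lemma enorm_half_diam x y : X x -> X y -> enorm (x - y) <= 2 * half_diam X.
Proof.
move=> Xx Xy; rewrite mulrC -ler_pdivrMr//.
apply: ub_le_sup; last by exists (x, y).
have [M [_ XM]] := compact_bounded compactX.
have {}XM z i : X z -> `|z 0 i| <= M + 1.
  move=> Xz; apply: le_trans (XM (M + 1) _ z Xz); last by rewrite ltrDl.
  rewrite (_ : `|z| = mx_norm z)// mx_normrE.
  exact: (le_bigmax _ (fun ij => `|z ij.1 ij.2|) (0, i)).
exists (Num.sqrt (\sum_(i < n) (2 * (M + 1)) ^+ 2) / 2) => _ [[u v] [Xu Xv] <-].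
rewrite ler_pM2r// ler_sqrt; last by apply: sumr_ge0 => i _; exact: sqr_ge0.
apply: ler_sum => i _; rewrite !mxE/= -[leLHS]real_normK ?num_real//.
have M0 : 0 <= M + 1 by exact: le_trans (XM u i Xu).
rewrite lerXn2r ?nnegrE ?mulr_ge0//.
apply: le_trans (ler_normB _ _) _.
by have := XM u i Xu; have := XM v i Xv; lra.
Qed.

Lemma borel_measurable_compact :
  measurable (X : set (borel_rV R n)).
Proof.
rewrite -[X]setCK; apply: measurableC; apply: sub_sigma_algebra.
exact: (closed_openC (compact_closed (@norm_hausdorff _ _) compactX)).
Qed.

End Diameter.

Section BorelMaps.
Context {R : realType} {n : nat}.

Lemma measurable_borel_coord (i : 'I_n) :
  measurable_fun setT (fun v : borel_rV R n => (v : 'rV[R]_n) 0 i).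
Proof.
move=> mT; apply: (measurability _ (RGenOInfty.measurableE R)) => //.
move=> _ [_ [a ->] <-]; rewrite setTI; apply: sub_sigma_algebra.
apply: open_comp => [v _|]; first exact: (@coord_continuous R 1 n).
by rewrite set_itvE; exact: open_gt.
Qed.

Lemma measurable_coord d (T : measurableType d) (D : set T)
    (u : T -> 'rV[R]_n) i :
  measurable_fun D (u : T -> borel_rV R n) ->
  measurable_fun D (fun w => u w 0 i).
Proof. move=> mu; exact: (measurableT_comp (measurable_borel_coord i) mu). Qed.

(* [X] meets [h > a] in the trace of the open set of all [z] with
   [h x - M |z - x| > a] for some [x] in [X]. *)
Lemma measurable_lipschitz (X : set 'rV[R]_n) (h : 'rV[R]_n -> R) M :
  lipschitz_bound X h M -> measurable_fun (X : set (borel_rV R n)) h.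
Proof.
move=> hM mX.
apply: (measurability _ (RGenOInfty.measurableE R)) => //.
move=> _ [_ [a ->] <-]; rewrite set_itvE.
pose U : set 'rV[R]_n := \bigcup_(x in X) [set z | a < h x - M * enorm (x - z)].
have -> : X `&` h @^-1` [set y | a < y] = X `&` U.
  apply/seteqP; split=> z [Xz].
    by move=> /= az; split=> //; exists z => //=; rewrite subrr enorm0 mulr0 subr0.
  move=> [x Xx /= ax]; split=> //=; apply: lt_le_trans ax _.
  by have := hM _ _ Xx Xz; lra.
apply: measurableI => //; apply: sub_sigma_algebra; apply: bigcup_open => x Xx.
apply: (@open_comp _ _ (fun z : 'rV[R]_n => h x - M * enorm (x - z) : R)
  [set y | a < y]) => [z _|]; last exact: open_gt.
have xz : (fun u : 'rV[R]_n => x - u) @ nbhs z --> x - z.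
  by apply: (@cvgB _ _ _ (nbhs z) _ (fun=> x) id); [exact: cvg_cst|exact: cvg_id].
have Mxz : (fun u : 'rV[R]_n => M * enorm (x - u)) @ nbhs z --> M * enorm (x - z).
  by apply: cvgM; [exact: cvg_cst|exact: cvg_enorm xz].
by apply: (@cvgB _ _ _ (nbhs z) _ (fun=> h x) _ _ _ _ Mxz); exact: cvg_cst.
Qed.

End BorelMaps.

Lemma measurable_enorm d (T : measurableType d) (R : realType) n (D : set T)
    (u : T -> 'rV[R]_n) :
  (forall i, measurable_fun D (fun w => u w 0 i)) ->
  measurable_fun D (fun w => enorm (u w)).
Proof.
move=> mu.
apply: (measurableT_comp (continuous_measurable_fun (@sqrt_continuous R))).
by apply: measurable_sum => i; exact: measurable_funX.
Qed.

(** Inversion is discontinuous at 0, hence the detour through the power function with exponent -1,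
    which agrees with 0^-1 = 0. *)
Lemma measurable_inv_nonneg d (T : measurableType d) (R : realType) (D : set T)
    (u : T -> R) : (forall w, 0 <= u w) ->
  measurable_fun D u -> measurable_fun D (fun w => (u w)^-1).
Proof.
move=> u0 mu; under eq_fun do rewrite -powR_inv1//.
exact: (measurableT_comp (measurable_powR (- 1)) mu).
Qed.

(** * Feasibility and complementarity at a saddle point *)

Section SaddlePoint.
Context {R : realType} {n m : nat}.
Variables (X : set 'rV[R]_n) (psi0 : 'rV[R]_n -> \bar R).
Variables (psi : 'rV[R]_n -> 'rV[R]_m) (xs : 'rV[R]_n) (ys : 'rV[R]_m).
Hypothesis saddle : saddle_point X psi0 psi xs ys.

Lemma saddle_fin : psi0 xs \is a fin_num.
Proof.
have [_ _ _] := saddle; rewrite /lagrangian.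
by case: (psi0 xs).
Qed.

Lemma saddle_dual y : nonneg_orthant y -> dotv y (psi xs) <= dotv ys (psi xs).
Proof.
have [Xxs ys0 opt _] := saddle; move=> y0.
have [+ _] := opt xs y Xxs y0.
by rewrite /lagrangian -(fineK saddle_fin) -!EFinD lee_fin lerD2l.
Qed.

(** Dual maximality of ys is tested at ys + e_i. *)
Lemma saddle_feasible i : psi xs 0 i <= 0.
Proof.
have [_ ys0 _ _] := saddle.
have /saddle_dual : nonneg_orthant (ys + delta_mx 0 i).
  by move=> j; rewrite mxE addr_ge0// mxE ler0n.
rewrite dotvDl gerDl /dotv (bigD1 i)//= big1 => [|j ji].
  by rewrite !mxE !eqxx mul1r addr0.
by rewrite !mxE (negbTE ji) andbF mul0r.
Qed.

Lemma saddle_complementarity : dotv ys (psi xs) = 0.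
Proof.
have [_ ys0 _ _] := saddle.
apply/eqP; rewrite eq_le; apply/andP; split.
  by apply: sumr_le0 => i _; rewrite mulr_ge0_le0// saddle_feasible.
have /saddle_dual : nonneg_orthant (0 : 'rV[R]_m) by move=> i; rewrite mxE.
by rewrite dot0v.
Qed.

Lemma saddle_primal x : X x -> (psi0 xs <= psi0 x + (dotv ys (psi x))%:E)%E.
Proof.
move=> Xx; have [Xxs ys0 opt _] := saddle.
have [_] := opt x ys Xx ys0.
by rewrite /lagrangian saddle_complementarity adde0.
Qed.

End SaddlePoint.

(** * Oracle noise relative to the past of the run *)

Section StochasticGradient.
Context d d' (T : measurableType d) (Om : measurableType d') (R : realType).
Context (n : nat) (P : probability T R) (xi : {RV P >-> Om}).
Variable G : set (set T).
Variables (X : set 'rV[R]_n) (F : 'rV[R]_n -> Om -> 'rV[R]_n).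
Variables (f' : 'rV[R]_n -> 'rV[R]_n) (xh q : T -> 'rV[R]_n) (sigma C : R).
Hypothesis mG : <<s G >> `<=` measurable.
Hypothesis ind : independent_of xi <<s G >>.
Hypothesis mX : measurable (X : set (borel_rV R n)).
Hypothesis mF : measurable_fun ((X : set (borel_rV R n)) `*` [set: Om])
  (fun p : borel_rV R n * Om => (F p.1 p.2 : borel_rV R n)).
Hypothesis Xxh : forall w, X (xh w).
Hypothesis vxh : vec_events xh `<=` <<s G >>.
Hypothesis mq : forall i,
  measurable_fun [set: g_sigma_algebraType G] (fun w => q w 0 i).
Hypothesis qC : forall w, enorm (q w) <= C.
Hypothesis meanF : forall x i, X x ->
  ('E_P[fun w => (F x (xi w) 0 i)%R] = (f' x 0 i)%R%:E)%E.
Hypothesis varF : forall x, X x ->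
  ('E_P[fun w => (enorm (F x (xi w) - f' x) ^+ 2)%R] <= (sigma ^+ 2)%:E)%E.

Let T1 := g_sigma_algebraType G.

(* [G] generates a sub-sigma-algebra of [T]: the identity onto [T1] is a random
   variable carrying exactly the information in [G]. *)
Let Z (w : T) : T1 := w.

Let mZ : measurable_fun [set: T] Z.
Proof. by move=> _ A mA; rewrite setTI; exact: mG. Qed.

HB.instance Definition _ := @isMeasurableFun.Build _ _ T T1 Z mZ.

Lemma measurable_vec_events (u : T -> 'rV[R]_n) i : vec_events u `<=` <<s G >> ->
  measurable_fun [set: T1] (fun w => u w 0 i).
Proof.
move=> vu; apply: (@measurable_coord _ _ _ T1 setT u i) => _ A mA.
by apply: vu; exists A.
Qed.

Let mPhi i : measurable_fun [set: T1 * Om] (fun p => F (xh p.1) p.2 0 i).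
Proof.
apply: (@measurable_coord _ _ _ (T1 * Om)%type setT (fun p => F (xh p.1) p.2) i).
apply: (@measurable_comp _ _ _ (T1 * Om)%type (borel_rV R n * Om)%type
  (borel_rV R n) ((X : set (borel_rV R n)) `*` [set: Om])
  (fun p => F p.1 p.2) setT (fun p => (xh p.1 : borel_rV R n, p.2))) => //.
- exact: measurableX.
- by move=> _ [p _ <-]; split=> //=; exact: Xxh.
apply: measurable_fun_pair; last exact: measurable_snd.
have mxh : measurable_fun [set: T1] (xh : T1 -> borel_rV R n).
  by move=> _ A mA; apply: vxh; exists A.
exact: (measurableT_comp mxh measurable_fst).
Qed.

Let indep A E : measurable A -> measurable E ->
  P ((xi @^-1` E) `&` (Z @^-1` A)) = (P (xi @^-1` E) * P (Z @^-1` A))%E.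
Proof. by move=> mA mE; exact: ind. Qed.

Let meanE (z : T1) i :
  (\int[P]_w (F (xh z) (xi w) 0 i)%:E)%E = (f' (xh z) 0 i)%:E.
Proof. by rewrite -meanF// unlock. Qed.

Let varE (z : T1) :
  (\int[P]_w (enorm (F (xh z) (xi w) - f' (xh z)) ^+ 2)%:E <= (sigma ^+ 2)%:E)%E.
Proof. by have := varF (Xxh z); rewrite unlock. Qed.

Let bias w := dotv (F (xh w) (xi w) - f' (xh w)) (q w).
Let variance w := enorm (F (xh w) (xi w) - f' (xh w)) ^+ 2.

(** The weights will be a = tau_j^2 and b = 2 / mu, which reproduces the noise of iteration j. *)
Lemma stochastic_gradient_noise (a b : R) : 0 <= b ->
  P.-integrable setT (fun w => (bias w / a + b * variance w)%:E) /\
  (\int[P]_w (bias w / a + b * variance w)%:E <= (b * sigma ^+ 2)%:E)%E.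
Proof.
move=> b0.
have ib : P.-integrable setT (fun w => (bias w)%:E).
  exact: (integrable_oracle_bias indep (Phi := fun z e => F (xh z) e)
    (mean := fun z => f' (xh z)) mPhi mq qC meanE varE).
have b0E : (\int[P]_w (bias w)%:E = 0)%E.
  exact: (oracle_unbiased indep (Phi := fun z e => F (xh z) e)
    (mean := fun z => f' (xh z)) mPhi mq qC meanE varE).
have iv : P.-integrable setT (fun w => (variance w)%:E).
  exact: (integrable_oracle_variance indep (Phi := fun z e => F (xh z) e)
    (mean := fun z => f' (xh z)) mPhi meanE varE).
have vE : (\int[P]_w (variance w)%:E <= (sigma ^+ 2)%:E)%E.
  exact: (oracle_variance indep (Phi := fun z e => F (xh z) e)
    (mean := fun z => f' (xh z)) mPhi meanE varE).
have ib' : P.-integrable setT (fun w => (bias w)%:E * (a^-1)%:E)%E.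
  exact: integrableZr.
have iv' : P.-integrable setT (fun w => b%:E * (variance w)%:E)%E.
  exact: integrableZl.
split.
  by under eq_fun do rewrite EFinD EFinM [(b * _)%:E]EFinM; exact: integrableD.
under eq_integral do rewrite EFinD EFinM [(b * _)%:E]EFinM.
rewrite integralD// integralZr// integralZl// b0E mul0e add0e EFinM.
by rewrite lee_wpmul2l// lee_fin.
Qed.

End StochasticGradient.

(** * Convergence in expectation *)

(** [S] will be the accumulated noise and [V] the term of a random multiplier, taken to be 0 when
    the multiplier is deterministic. *)
Lemma integral_affine_le d (T : measurableType d) (R : realType)
    (P : probability T R) (V S : T -> R) (a b c v s : R) :
  P.-integrable setT (EFin \o V) -> P.-integrable setT (EFin \o S) -> 0 <= c ->
  (\int[P]_w (V w)%:E = v%:E)%E -> (\int[P]_w (S w)%:E <= s%:E)%E ->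
  (\int[P]_w (a + b * V w + c * S w)%:E <= (a + b * v + c * s)%:E)%E.
Proof.
move=> iV iS c0 vE sE.
have ibV : P.-integrable setT (fun w => b%:E * (V w)%:E)%E by exact: integrableZl.
have icS : P.-integrable setT (fun w => c%:E * (S w)%:E)%E by exact: integrableZl.
have ia : P.-integrable setT (EFin \o cst a).
  exact: finite_measure_integrable_cst.
under eq_integral do rewrite !EFinD [(b * _)%:E]EFinM [(c * _)%:E]EFinM.
rewrite integralD//; last by exact: integrableD.
rewrite integralD// !integralZl// integral_probability_cst vE !EFinD !EFinM.
by rewrite leeD2l// lee_wpmul2l// lee_fin.
Qed.

Section PositivePart.
Context {R : realType} {m : nat}.
Implicit Types u : 'rV[R]_m.

(** The direction in which <., u> recovers the infeasibility |[u]_+|; it is 0 when u <= 0. *)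
Definition pos_direction u : 'rV[R]_m := (enorm (pospart u))^-1 *: pospart u.

Lemma pospart_ge0 u i : 0 <= pospart u 0 i.
Proof. by rewrite mxE le_max lexx orbT. Qed.

Lemma pospart_ge u i : u 0 i <= pospart u 0 i.
Proof. by rewrite mxE le_max lexx. Qed.

Lemma pos_direction_ge0 u i : 0 <= pos_direction u 0 i.
Proof. by rewrite mxE mulr_ge0 ?invr_ge0 ?enorm_ge0 ?pospart_ge0. Qed.

Lemma enorm_pos_direction u : enorm (pos_direction u) <= 1.
Proof.
rewrite enormZ ?invr_ge0 ?enorm_ge0//.
have [->|p0] := eqVneq (enorm (pospart u)) 0; first by rewrite mulr0.
by rewrite mulVf.
Qed.

Lemma dotv_pos_direction u : dotv (pos_direction u) u = enorm (pospart u).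
Proof.
have -> : dotv (pos_direction u) u
    = (enorm (pospart u))^-1 * enorm (pospart u) ^+ 2.
  rewrite dotvZl enorm_sqr; congr (_ * _); apply: eq_bigr => i _.
  by rewrite mxE; have [u0|u0] := leP (u 0 i) 0; rewrite ?mul0r.
have [->|p0] := eqVneq (enorm (pospart u)) 0; first by rewrite expr0n mulr0.
by rewrite expr2 mulKf.
Qed.

Lemma measurable_pospart d (T : measurableType d) (D : set T)
    (u : T -> 'rV[R]_m) i : (forall i, measurable_fun D (fun w => u w 0 i)) ->
  measurable_fun D (fun w => pospart (u w) 0 i).
Proof.
move=> mu; under eq_fun do rewrite mxE.
by apply: measurable_maxr; [exact: mu|exact: measurable_cst].
Qed.

Lemma measurable_pos_direction d (T : measurableType d) (D : set T)
    (u : T -> 'rV[R]_m) i : (forall i, measurable_fun D (fun w => u w 0 i)) ->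
  measurable_fun D (fun w => pos_direction (u w) 0 i).
Proof.
move=> mu; under eq_fun do rewrite mxE.
apply: measurable_funM; last exact: measurable_pospart.
apply: measurable_inv_nonneg => [w|]; first exact: enorm_ge0.
by apply: measurable_enorm => j; exact: measurable_pospart.
Qed.

End PositivePart.

(** * Assembly of the three estimates *)

Theorem theorem3 (R : realType) (n m : nat)
  (* problem *)
  (X : set 'rV[R]_n) (f : 'rV[R]_n -> R) (chi0 : 'rV[R]_n -> \bar R)
  (g chi : 'I_m -> 'rV[R]_n -> R)
  (mu Lf Hf : R) (Lgi Hgi Mgi Mchii : 'I_m -> R) (Lg Hg Mg Mchi : R)
  (* first-order information and stochastic oracle *)
  (f' : 'rV[R]_n -> 'rV[R]_n) (g' : 'I_m -> 'rV[R]_n -> 'rV[R]_n)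
  (d d' : measure_display) (T : measurableType d) (Om : measurableType d')
  (P : probability T R) (xi : nat -> {RV P >-> Om})
  (F : 'rV[R]_n -> Om -> 'rV[R]_n) (sigma : R)
  (* saddle point *)
  (xs : 'rV[R]_n) (ys : 'rV[R]_m)
  (* method *)
  (B : R) (K : nat) (x1 : 'rV[R]_n) (y1 : 'rV[R]_m)
  (rho eta L tau beta : nat -> R) (it : T -> iterates R n m) :
  let psi0 x := ((f x)%:E + chi0 x)%E in
  let gv x : 'rV[R]_m := \row_(i < m) g i x in
  let chiv x : 'rV[R]_m := \row_(i < m) chi i x in
  let psi x : 'rV[R]_m := gv x + chiv x in
  let Gm x : 'M[R]_(m, n) := \matrix_(i < m) g' i x in
  let sgrad k w := F (it_xh (it w) k) (xi k w) in
  let x k w := it_x (it w) k in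
  let D := half_diam X in
  let N := enorm ys in
  let pos (t : R) := Num.max t 0 in
  let yhat w : 'rV[R]_m :=
    let p := pospart (psi (x K w)) in
    if p == 0 then 0 else (N + 1) *: ((enorm p)^-1 *: p) in
  let Hstar := Lg * D * pos (N + 1 - B) + Hg * (N + 1) in
  (* standing assumptions *)
  convex_set (X : set (convex_lmodType 'rV[R]_n)) -> compact X ->
  convex_function (X : set (convex_lmodType 'rV[R]_n)) f ->
  (forall i, convex_function (X : set (convex_lmodType 'rV[R]_n)) (g i)) ->
  econvex_on X chi0 -> proper_on X chi0 ->
  lower_semicontinuous (chi0 : subspace X -> \bar R) ->
  (forall i, convex_function (X : set (convex_lmodType 'rV[R]_n)) (chi i)) ->
  (forall i, {within X, continuous (chi i)}) ->
  0 < mu -> strongly_convex X f mu ->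
  0 <= Lf -> 0 <= Hf ->
  (forall i, [/\ 0 <= Lgi i, 0 <= Hgi i, 0 <= Mgi i & 0 <= Mchii i]) ->
  upper_model X f Lf Hf ->
  (forall i, upper_model X (g i) (Lgi i) (Hgi i)) ->
  (forall i, lipschitz_bound X (g i) (Mgi i)) ->
  (forall i, lipschitz_bound X (chi i) (Mchii i)) ->
  Lg = Num.sqrt (\sum_(i < m) Lgi i ^+ 2) ->
  Hg = Num.sqrt (\sum_(i < m) Hgi i ^+ 2) ->
  Mg = Num.sqrt (\sum_(i < m) Mgi i ^+ 2) ->
  Mchi = Num.sqrt (\sum_(i < m) Mchii i ^+ 2) ->
  0 < Mg + Mchi ->
  (forall z, X z -> subdiff X f z (f' z)) ->
  (forall i z, X z -> subdiff X (g i) z (g' i z)) ->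
  saddle_point X psi0 psi xs ys ->
  (* stochastic oracle *)
  0 <= sigma ->
  stochastic_oracle X F f' sigma [set k | (1 <= k < K)%N] xi ->
  mutually_independent [set k | (1 <= k < K)%N] xi ->
  (forall k, (1 <= k < K)%N -> independent_of (xi k) (past it sgrad k)) ->
  past it sgrad K `<=` measurable ->
  (* run of the method *)
  0 <= B -> (2 <= K)%N -> X x1 ->
  (forall w, aug_conex X chi0 gv chiv Gm rho eta L tau beta K x1 y1
               (fun k => sgrad k w) (it w)) ->
  (forall k w, (1 <= k < K)%N -> X (it_xh (it w) k)) ->
  (* parameters *)
  tau 1%N = 1 ->
  rho 1%N = mu / (2 * (Mg + Mchi) ^+ 2) ->
  (forall k, (1 <= k)%N ->
     tau k.+1 = tau k / 2 * (Num.sqrt (tau k ^+ 2 + 4) - tau k)) ->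
  (forall k, (1 <= k)%N -> rho k.+1 = rho 1%N / tau k.+1 ^+ 2) ->
  (forall k, (1 <= k)%N -> eta k = rho k) ->
  (forall k, (1 <= k)%N ->
     beta k.+1 = (1 - tau k) * tau k * L k
                 / (tau k ^+ 2 * L k + L k.+1 * tau k.+1)) ->
  (forall k, (1 <= k)%N ->
     L k = 2 * (Lf + B * Lg + rho k * (Mg + Mchi) ^+ 2)) ->
  [/\ (\int[P]_w (psi0 (x K w) - psi0 xs)
       <= (4 / K%:R ^+ 2 *
             (4 * (Lf + B * Lg) * D ^+ 2
              + 1 / (2 * eta 1%N) * enorm y1 ^+ 2)
           + 8 * (K%:R + 2) * (Hf ^+ 2 + sigma ^+ 2)
             / (mu * K%:R ^+ 2))%:E)%E,
      ('E_P[fun w => enorm (pospart (psi (x K w)))]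
       <= (4 / K%:R ^+ 2)%:E *
            (((Lf + B * Lg) * enorm (x1 - xs) ^+ 2)%:E
             + (1 / (2 * eta 1%N))%:E
               * 'E_P[fun w => (enorm (y1 - yhat w) ^+ 2)%R])
          + (4 * (K%:R + 2) * (Hstar ^+ 2 + 2 * (Hf ^+ 2 + sigma ^+ 2))
             / (mu * K%:R ^+ 2))%:E)%E
    & ('E_P[fun w => (enorm (1 / tau K.-1 *:
                (x K w - (1 - tau K.-1) *: x K.-1 w) - xs) ^+ 2)%R]
       <= (8 / (mu * K%:R ^+ 2) *
             (4 * (Lf + B * Lg) * enorm (x1 - xs) ^+ 2
              + 2 / eta 1%N * enorm (y1 - ys) ^+ 2
              + 4 * (K%:R + 2)
                * ((Lg * D * pos (N - B) + Hg * N) ^+ 2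
                   + 2 * (Hf ^+ 2 + sigma ^+ 2)) / mu))%:E)%E].
Proof.
move=> psi0 gv chiv psi Gm sgrad x D N pos yhat Hstar convX compX convf convg.
move=> convchi0 propchi0 _ convchi _ mu0 scf Lf0 Hf0 cst0 upf upg lipg lipchi.
move=> LgE HgE _ _ M0 f'P g'P saddle sigma0 [mF orc] _ indep pastK B0 K2 Xx1 run.
move=> Xxh tau1 rho1E tauS rhoS etaE betaS LE.
have [Xxs ys0 _ _] := saddle.
have finpsi0 := saddle_fin saddle.
have finxs : chi0 xs \is a fin_num by move: finpsi0; rewrite fin_numD => /andP[].
have diamX := enorm_half_diam compX.
have KE : K = K.-1.+1 by rewrite prednK// ltnW.
have k1 : (1 <= K.-1)%N by rewrite -ltnS -KE.
have kK : (1 <= K.-1 < K)%N by rewrite k1 -KE leqnn.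
have jK j : (1 <= j < K)%N -> (1 <= j <= K)%N by case/andP=> -> /ltnW.
have inv w := iterates_invariant propchi0 Xxs finxs etaE Xx1 (run w).
have feas := saddle_feasible saddle.
have rho10 := rho1_gt0 mu0 M0 rho1E.
pose c0 z := fine (chi0 z).
set k := K.-1 in k1 KE kK *.
set t := tau k.
have t0 : 0 < t := tau_gt0 tau1 tauS k1.
pose noise j w : R :=
  dotv (sgrad j w - f' (it_xh (it w) j))
    (tau j *: xs + (1 - tau j) *: x j w - it_xh (it w) j) / tau j ^+ 2
  + 2 / mu * enorm (sgrad j w - f' (it_xh (it w) j)) ^+ 2.
pose S w := \sum_(1 <= j < K) noise j w.
pose Hy Yb := Lg * D * pos (Yb - B) + Hg * Yb.
have bound w (y : 'rV[R]_m) Yb : (forall i, 0 <= y 0 i) -> enorm y <= Yb ->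
    (f (x K w) + c0 (x K w) + dotv y (it_V (it w) K) - (f xs + c0 xs)) / t ^+ 2
    + L k / 2 * enorm (1 / t *: (x K w - (1 - t) *: x k w) - xs) ^+ 2 <=
    (Lf + B * Lg) * enorm (x1 - xs) ^+ 2
    + 1 / (2 * rho 1%N) * enorm (y - y1) ^+ 2 + S w
    + k%:R * ((Hy Yb ^+ 2 + 2 * Hf ^+ 2) / mu).
  move=> y0 yY; subst Lg Hg.
  have := iterates_bound convX convchi0 propchi0 convg convchi mu0 scf upf upg
    lipg f'P g'P diamX Lf0 B0 Xxs finxs feas tau1 tauS M0 rho1E rhoS etaE betaS
    LE Xx1 (run w) (Xxh ^~ w) kK y0 yY.
  rewrite -KE -/(S w); apply: le_trans.
  (* The nonnegative dual distance is dropped. *)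
  by rewrite lerDl mulr_ge0 ?sqr_ge0// divr_ge0// mulr_ge0// ltW.
have mX := borel_measurable_compact compX.
have noiseE j : (1 <= j < K)%N -> P.-integrable setT (EFin \o noise j) /\
    (\int[P]_w (noise j w)%:E <= (2 / mu * sigma ^+ 2)%:E)%E.
  move=> jltK; have /andP[j1 ltjK] := jltK.
  (* The past grows with j, so its measurability at K is inherited. *)
  have pj : past it sgrad j `<=` measurable.
    apply: subset_trans pastK; apply: sub_sigma_algebra2 => A.
    case=> -[i /andP[i1 ij] Ai]; [left|right]; exists i => //=.
      by rewrite i1 (leq_trans ij)// ltnW.
    by rewrite i1 (ltn_trans ij).
  have vx : vec_events (x j) `<=` past it sgrad j.
    move=> A Ax; apply: sub_sigma_algebra; left; exists j => /=.
      by rewrite j1 leqnn.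
    by do 5 left.
  have vxh : vec_events (fun w => it_xh (it w) j) `<=` past it sgrad j.
    move=> A Ax; apply: sub_sigma_algebra; left; exists j => /=.
      by rewrite j1 leqnn.
    by do 4 left; right.
  have [Gj GjE] : exists Gj, past it sgrad j = <<s Gj >>.
    by rewrite /past; eexists.
  have indj := indep j jltK; rewrite GjE in pj vx vxh indj.
  have tj0 : 0 <= tau j by rewrite ltW ?(tau_gt0 tau1 tauS).
  have tj1 : tau j <= 1 := tau_le1 tau1 tauS j1.
  pose q w := tau j *: xs + (1 - tau j) *: x j w - it_xh (it w) j.
  have qD w : enorm (q w) <= 2 * D.
    apply: diamX; last exact: Xxh.
    apply: convex_set_segment => //; last by rewrite tj0.
    by have [] := inv w j (jK j jltK).
  have b0 : 0 <= 2 / mu by rewrite divr_ge0// ltW.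
  have mq i : measurable_fun [set: g_sigma_algebraType Gj] (fun w => q w 0 i).
    have -> : (fun w => q w 0 i) = (fun w => tau j * xs 0 i
        + (1 - tau j) * x j w 0 i - it_xh (it w) j 0 i).
      by apply/funext => w; rewrite !mxE.
    apply: measurable_funB; last exact: measurable_vec_events vxh.
    apply: measurable_funD; first exact: measurable_cst.
    apply: measurable_funM; first exact: measurable_cst.
    exact: measurable_vec_events vx.
  have mean z i : X z -> ('E_P[fun w => (F z (xi j w) 0 i)%R] = (f' z 0 i)%R%:E)%E.
    by move=> Xz; have [/(_ i)] := orc j z jltK Xz.
  have var z : X z ->
      ('E_P[fun w => (enorm (F z (xi j w) - f' z) ^+ 2)%R] <= (sigma ^+ 2)%:E)%E.
    by move=> Xz; have [] := orc j z jltK Xz.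
  exact: (stochastic_gradient_noise pj indj mX mF
    (fun w => Xxh j w jltK) vxh mq qD mean var (tau j ^+ 2) b0).
have noiseI (j : 'I_k) : (1 <= j.+1 < K)%N by rewrite /= KE ltnS ltn_ord.
have SE w : (S w)%:E = (\sum_(j < k) (noise j.+1 w)%:E)%E.
  by rewrite /S KE big_add1 big_mkord sumEFin.
have intS : P.-integrable setT (EFin \o S).
  have -> : EFin \o S = (fun w => \sum_(j < k) (noise j.+1 w)%:E)%E.
    by apply/funext => w; exact: SE.
  by apply: integrable_sum => // j _; have [] := noiseE _ (noiseI j).
have ES : (\int[P]_w (S w)%:E <= (k%:R * (2 / mu * sigma ^+ 2))%:E)%E.
  under eq_integral do rewrite SE.
  rewrite integral_sum//; last by move=> j; have [] := noiseE _ (noiseI j).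
  apply: (@le_trans _ _ (\sum_(j < k) (2 / mu * sigma ^+ 2)%:E)%E).
    by apply: lee_sum => j _; have [] := noiseE _ (noiseI j).
  by rewrite sumEFin sumr_const card_ord [k%:R * _]mulr_natl.
have KK : (1 <= K <= K)%N by rewrite leqnn ltnW.
have psi0E w : psi0 (x K w) = (f (x K w) + c0 (x K w))%:E.
  (* K >= 2 makes x_K the output of a proximal step, so [chi0] is finite there. *)
  have [_ _ _ _ [K1|finx]] := inv w K KK; first by rewrite K1 in K2.
  by rewrite /psi0 EFinD fineK.
have psi0sE : psi0 xs = (f xs + c0 xs)%:E by rewrite EFinD fineK.
have dualV w (y : 'rV[R]_m) : (forall i, 0 <= y 0 i) ->
    dotv y (psi (x K w)) <= dotv y (it_V (it w) K).
  move=> y0; apply: dotv_le => // i.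
  have [_ _ s0 -> _] := inv w K KK.
  by rewrite [leRHS]mxE [X in _ + X]mxE lerDl oppr_ge0.
have saddleK w : f xs + c0 xs <= f (x K w) + c0 (x K w) + dotv ys (psi (x K w)).
  have XK : X (x K w) by have [] := inv w K KK.
  by have := saddle_primal saddle XK; rewrite psi0E psi0sE -EFinD lee_fin.
have N1 : 0 <= N + 1 := addr_ge0 (enorm_ge0 ys) ler01.
have t2 : t ^+ 2 <= 4 / K%:R ^+ 2.
  have := tau_le tau1 tauS k1; rewrite -KE -/t => tK.
  have -> : 4 / K%:R ^+ 2 = (2 / K%:R) ^+ 2 :> R.
    by rewrite expr_div_n; congr (_ / _); rewrite -natrX.
  by rewrite lerXn2r ?nnegrE ?divr_ge0// ltW.
have t20 : 0 < t ^+ 2 by rewrite exprn_gt0.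
have Kr0 : 0 < K%:R :> R by rewrite ltr0n ltnW.
have kr : k%:R = K%:R - 1 :> R by rewrite KE -(natr1 k) addrK.
have kr0 : 0 <= k%:R :> R by [].
have Lt0 : 0 <= Lf + B * Lg by rewrite addr_ge0// mulr_ge0// LgE sqrtr_ge0.
have LkE : L k = 2 * (Lf + B * Lg) + mu / t ^+ 2.
  by rewrite LE// (rho_tau tau1 rhoS k1) rho1E -/t; field; rewrite !gt_eqF.
have Lk0 : 0 <= L k.
  by rewrite LkE addr_ge0//; [exact: mulr_ge0|rewrite divr_ge0// ltW].
have d1 : enorm (x1 - xs) ^+ 2 <= 4 * D ^+ 2.
  have := diamX _ _ Xx1 Xxs; have := enorm_ge0 (x1 - xs) => e0 eD.
  have -> : 4 * D ^+ 2 = (2 * D) ^+ 2 by ring.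
  by rewrite lerXn2r ?nnegrE// (le_trans e0).
have Ld0 : 0 <= (Lf + B * Lg) * enorm (x1 - xs) ^+ 2.
  by rewrite mulr_ge0 ?sqr_ge0.
have var_ge0 h : 0 <= (h ^+ 2 + 2 * (Hf ^+ 2 + sigma ^+ 2)) / mu.
  rewrite divr_ge0 ?(ltW mu0)//.
  by have := sqr_ge0 h; have := sqr_ge0 Hf; have := sqr_ge0 sigma; lra.
have i0 : P.-integrable setT (EFin \o cst (0 : R)).
  exact: finite_measure_integrable_cst.
have e0 : (\int[P]_w (cst (0 : R) w)%:E = 0%:E)%E.
  exact: (integral_probability_cst P 0%:E).
have scale a q b : 0 <= q -> a / t ^+ 2 + q <= b -> a <= t ^+ 2 * b.
  by move=> q0 h; rewrite mulrC -ler_pdivrMr//; lra.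
have rate p p' : 0 <= p <= p' -> t ^+ 2 * p <= 4 / K%:R ^+ 2 * p'.
  by move=> /andP[p0 pp']; apply: ler_pM => //; exact: ltW.
pose Y (y : 'rV[R]_m) := 1 / (2 * rho 1%N) * enorm (y - y1) ^+ 2.
have Y0 y : 0 <= Y y.
  by rewrite mulr_ge0 ?sqr_ge0// divr_ge0// mulr_ge0// ltW.
have Y0E : Y 0 = 1 / (2 * eta 1%N) * enorm y1 ^+ 2.
  by rewrite /Y enorm_distC subr0 etaE.
split.
- have Hy0 : Hy 0 = 0.
    by rewrite /Hy /pos max_r ?sub0r ?oppr_le0// !mulr0 addr0.
  pose a := t ^+ 2 * ((Lf + B * Lg) * enorm (x1 - xs) ^+ 2 + Y 0
    + k%:R * (2 * Hf ^+ 2 / mu)).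
  have pw w : (psi0 (x K w) - psi0 xs
      <= (a + 0 * cst 0 w + t ^+ 2 * S w)%:E)%E.
    rewrite psi0E psi0sE -EFinB lee_fin.
    have zero_ge0 i : 0 <= (0 : 'rV[R]_m) 0 i by rewrite mxE.
    have enorm0_le : enorm (0 : 'rV[R]_m) <= 0 by rewrite enorm0.
    have := bound w 0 0 zero_ge0 enorm0_le.
    rewrite -/(Y 0) dot0v addr0 Hy0 expr0n add0r => /scale.
    rewrite mulr_ge0 ?sqr_ge0 ?divr_ge0// => /(_ isT).
    by rewrite /a /=; lra.
  apply: le_trans (le_integral_pointwise P pw) _.
  apply: le_trans (integral_affine_le a 0 i0 intS (ltW t20) e0 ES) _.
  rewrite lee_fin -Y0E.
  have -> : a + 0 * 0 + t ^+ 2 * (k%:R * (2 / mu * sigma ^+ 2)) =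
      t ^+ 2 * ((Lf + B * Lg) * enorm (x1 - xs) ^+ 2 + Y 0
        + k%:R * (2 * (Hf ^+ 2 + sigma ^+ 2) / mu)).
    by rewrite /a; ring.
  have -> : 4 / K%:R ^+ 2 * (4 * (Lf + B * Lg) * D ^+ 2 + Y 0)
      + 8 * (K%:R + 2) * (Hf ^+ 2 + sigma ^+ 2) / (mu * K%:R ^+ 2) =
      4 / K%:R ^+ 2 * (4 * (Lf + B * Lg) * D ^+ 2 + Y 0
        + (K%:R + 2) * (2 * (Hf ^+ 2 + sigma ^+ 2) / mu)).
    by field; rewrite !gt_eqF.
  have c00 : 0 <= 2 * (Hf ^+ 2 + sigma ^+ 2) / mu.
    by rewrite divr_ge0 ?(ltW mu0)// mulr_ge0// addr_ge0 ?sqr_ge0.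
  apply: rate; apply/andP; split.
    exact: (addr_ge0 (addr_ge0 Ld0 (Y0 0)) (mulr_ge0 kr0 c00)).
  (* The number K - 1 of summed steps is relaxed to K + 2, and |x1 - xs|^2 to 4 D^2. *)
  by rewrite kr; have := ler_wpM2l Lt0 d1; lra.
- have yhatE w : yhat w = (N + 1) *: pos_direction (psi (x K w)).
    (* The test [p == 0] in [yhat] is redundant: [0^-1 = 0]. *)
    rewrite /yhat /pos_direction; case: eqP => // ->.
    by rewrite !scaler0.
  have yhat_ge0 w i : 0 <= yhat w 0 i.
    by rewrite yhatE mxE mulr_ge0 ?pos_direction_ge0.
  have yhat_le w : enorm (yhat w) <= N + 1.
    by rewrite yhatE enormZ// ler_piMr// enorm_pos_direction.
  pose V w := enorm (y1 - yhat w) ^+ 2.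
  have mV : measurable_fun setT V.
    apply: measurable_funX; apply: measurable_enorm => i.
    have -> : (fun w => (y1 - yhat w) 0 i)
        = (fun w => y1 0 i - (N + 1) * pos_direction (psi (x K w)) 0 i).
      by apply/funext => w; rewrite yhatE !mxE.
    apply: measurable_funB; first exact: measurable_cst.
    apply: measurable_funM; first exact: measurable_cst.
    apply: measurable_pos_direction => j.
    have -> : (fun w => psi (x K w) 0 j)
        = (fun w => (g j \+ chi j) (x K w)).
      by apply/funext => w; rewrite !mxE.
    have mxK : measurable_fun [set: T] (x K : T -> borel_rV R n).
      move=> _ A mA; apply: pastK; apply: sub_sigma_algebra; left; exists K => /=.
        by rewrite leqnn ltnW.
      by do 5 left; exists A.
    apply: (@measurable_comp _ _ _ T (borel_rV R n) R
      (X : set (borel_rV R n)) (g j \+ chi j)%R setT (x K)) => //.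
      by move=> _ [w _ <-]; have [] := inv w K KK.
    by apply: measurable_funD; apply: measurable_lipschitz.
  have V0 w : 0 <= V w := sqr_ge0 _.
  have iV : P.-integrable setT (EFin \o V).
    have iC : P.-integrable setT
        (EFin \o cst (2 * enorm y1 ^+ 2 + 2 * (N + 1) ^+ 2)).
      exact: finite_measure_integrable_cst.
    apply: le_integrable iC => //; first exact/measurable_EFinP.
    move=> w _; rewrite lee_fin /= (ger0_norm (V0 w)).
    apply: le_trans (enormB_sqr_le _ _) _; apply: le_trans (ler_norm _).
    by rewrite lerD2l ler_pM2l// lerXn2r ?nnegrE ?enorm_ge0.
  pose v := fine (\int[P]_w (V w)%:E)%E.
  have vE : (\int[P]_w (V w)%:E = v%:E)%E.
    by rewrite /v fineK//; exact: (integrable_fin_num measurableT iV).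
  have v0 : 0 <= v by rewrite /v fine_ge0// integral_ge0// => w _; rewrite lee_fin.
  pose a := t ^+ 2 * ((Lf + B * Lg) * enorm (x1 - xs) ^+ 2
    + k%:R * ((Hstar ^+ 2 + 2 * Hf ^+ 2) / mu)).
  pose b := t ^+ 2 * (1 / (2 * rho 1%N)).
  have pw w : ((enorm (pospart (psi (x K w))))%:E
      <= (a + b * V w + t ^+ 2 * S w)%:E)%E.
    rewrite lee_fin.
    have := bound w (yhat w) (N + 1) (yhat_ge0 w) (yhat_le w).
    move=> /scale; rewrite mulr_ge0 ?sqr_ge0 ?divr_ge0// => /(_ isT).
    (* With p = [psi(x_K)]_+, the multiplier contributes (|ys| + 1) |p|, while the saddle point
       gives psi0(x_K) - psi0(xs) >= -<ys, p> >= -|ys| |p|; the sum is at least |p|. *)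
    have := dualV w _ (yhat_ge0 w).
    rewrite yhatE dotvZl dotv_pos_direction -yhatE.
    have := saddleK w.
    have ysp : dotv ys (psi (x K w)) <= dotv ys (pospart (psi (x K w))).
      by apply: dotv_le => // i; exact: pospart_ge.
    have := cauchy_schwarz ys (pospart (psi (x K w))).
    rewrite -/N (_ : Hy (N + 1) = Hstar)// (enorm_distC (yhat w)) -/(V w) /a /b.
    by move: ysp; lra.
  rewrite unlock vE; apply: le_trans (le_integral_pointwise P pw) _.
  apply: le_trans (integral_affine_le a b iV intS (ltW t20) vE ES) _.
  rewrite -!EFinM -!EFinD lee_fin.
  pose c := (Hstar ^+ 2 + 2 * (Hf ^+ 2 + sigma ^+ 2)) / mu.
  have c0' : 0 <= c := var_ge0 Hstar.
  have -> : a + b * v + t ^+ 2 * (k%:R * (2 / mu * sigma ^+ 2)) =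
      t ^+ 2 * ((Lf + B * Lg) * enorm (x1 - xs) ^+ 2
        + 1 / (2 * rho 1%N) * v + k%:R * c).
    by rewrite /a /b /c; ring.
  rewrite etaE//.
  have -> : 4 * (K%:R + 2) * (Hstar ^+ 2 + 2 * (Hf ^+ 2 + sigma ^+ 2))
       / (mu * K%:R ^+ 2) = 4 / K%:R ^+ 2 * ((K%:R + 2) * c).
    by rewrite /c; field; rewrite !gt_eqF.
  have r0 : 0 <= 1 / (2 * rho 1%N) by rewrite divr_ge0// mulr_ge0// ltW.
  rewrite -mulrDr; apply: rate; apply/andP; split.
    exact: (addr_ge0 (addr_ge0 Ld0 (mulr_ge0 r0 v0)) (mulr_ge0 kr0 c0')).
  by rewrite lerD2l ler_wpM2r// kr; lra.
- pose H := Lg * D * pos (N - B) + Hg * N.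
  (* 1 / c is the strong-convexity share mu / (2 t^2) of L_k / 2, the only part of the distance
     coefficient that is kept. *)
  pose c := 2 * t ^+ 2 / mu.
  have c_ge0 : 0 <= c by rewrite divr_ge0 ?(ltW mu0)// mulr_ge0// ltW.
  pose a := c * ((Lf + B * Lg) * enorm (x1 - xs) ^+ 2 + Y ys
    + k%:R * ((H ^+ 2 + 2 * Hf ^+ 2) / mu)).
  have pw w : ((enorm (1 / t *: (x K w - (1 - t) *: x k w) - xs) ^+ 2)%:E
      <= (a + 0 * cst 0 w + c * S w)%:E)%E.
    rewrite lee_fin; set z := enorm _ ^+ 2.
    have z0 : 0 <= z := sqr_ge0 _.
    have := bound w ys N ys0 (lexx _); rewrite -/(Y ys) -/z (_ : Hy N = H)//.
    set gap := (X in X / _ + _).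
    have gap0 : 0 <= gap.
      by rewrite /gap; have := dualV w ys ys0; have := saddleK w; lra.
    have gap0' : 0 <= gap / t ^+ 2 by rewrite divr_ge0// ltW.
    have -> : L k / 2 = Lf + B * Lg + c^-1.
      by rewrite LkE /c; field; rewrite !gt_eqF.
    have Ltz := mulr_ge0 Lt0 z0.
    move=> h.
    have c_gt0 : 0 < c by rewrite divr_gt0// mulr_gt0.
    have : c^-1 * z <= (Lf + B * Lg) * enorm (x1 - xs) ^+ 2 + Y ys + S w
        + k%:R * ((H ^+ 2 + 2 * Hf ^+ 2) / mu) by lra.
    by rewrite ler_pdivrMl// /a /=; lra.
  rewrite unlock; apply: le_trans (le_integral_pointwise P pw) _.
  apply: le_trans (integral_affine_le a 0 i0 intS c_ge0 e0 ES) _.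
  rewrite lee_fin.
  pose e := (H ^+ 2 + 2 * (Hf ^+ 2 + sigma ^+ 2)) / mu.
  have e_ge0 : 0 <= e := var_ge0 H.
  have -> : a + 0 * 0 + c * (k%:R * (2 / mu * sigma ^+ 2)) =
      t ^+ 2 * (2 / mu * ((Lf + B * Lg) * enorm (x1 - xs) ^+ 2 + Y ys
        + k%:R * e)).
    by rewrite /a /c /e; field; rewrite gt_eqF.
  have -> : 2 / eta 1%N * enorm (y1 - ys) ^+ 2 = 4 * Y ys.
    by rewrite /Y etaE// enorm_distC; field; rewrite gt_eqF.
  have -> : 8 / (mu * K%:R ^+ 2) * (4 * (Lf + B * Lg) * enorm (x1 - xs) ^+ 2
      + 4 * Y ys + 4 * (K%:R + 2)
        * ((Lg * D * pos (N - B) + Hg * N) ^+ 2 + 2 * (Hf ^+ 2 + sigma ^+ 2))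
        / mu) = 4 / K%:R ^+ 2 * (2 / mu
      * (4 * ((Lf + B * Lg) * enorm (x1 - xs) ^+ 2 + Y ys + (K%:R + 2) * e))).
    by rewrite -/H /e; field; rewrite !gt_eqF.
  have mu2 : 0 <= 2 / mu by rewrite divr_ge0// ltW.
  have ke : 0 <= k%:R * e by rewrite mulr_ge0.
  apply: rate; apply/andP; split.
    exact: (mulr_ge0 mu2 (addr_ge0 (addr_ge0 Ld0 (Y0 ys)) ke)).
  (* The inner factor 4 of the stated bound is slack, absorbed by nonnegativity of each term. *)
  rewrite ler_wpM2l//; have := Y0 ys; move: ke; rewrite kr; lra.
Qed.
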